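(* Let $n\ge 2$ and consider the Stiefel manifold $V_{n,1}=U(n)/U_n(n-1)$ with its sub-Riemannian structure $(\mathcal H,\langle\cdot,\cdot\rangle)$. The cut locus $K_{Id}$ of the point $Id=[I_n]\in V_{n,1}$ is $$K_{Id}=L:=\left\{\left[\begin{pmatrix} C & 0\\ 0& D\end{pmatrix}\right] \;\Big|\; C\in U(1),\ D\in U(n-1)\right\}\setminus\{Id\}.$$
   Context: For $1\le k<n$ let $U_n(n-k)=\left\{\begin{pmatrix} I_k&0\\0&W\end{pmatrix}: W\in U(n-k)\right\}\subset U(n)$. The Stiefel manifold is $V_{n,k}=U(n)/U_n(n-k)$ (right cosets identification $q\sim q h$, $h\in U_n(n-k)$), with projection $\pi_1:U(n)\to V_{n,k}$, $q\mapsto[q]$; it is identified with $\{X\in\mathbb C^{n\times k}:\bar X^TX=I_k\}$ by taking the first $k$ columns of $q$. Here $k=1$. Sub-Riemannian structure: the horizontal space at $[q]$ is $$\mathcal H_{[q]}=\left\{d_q\pi_1\left(q\begin{pmatrix}0&B\\-\bar B^T&0\end{pmatrix}\right): B\in\mathbb C^{k\times(n-k)}\right\},$$ and the inner product on $\mathcal H_{[q]}$ is $\left\langle d_q\pi_1(q\mathcal X),d_q\pi_1(q\mathcal Y)\right\rangle=-2n\,\mathrm{tr}(\mathcal X\mathcal Y)$ for $\mathcal X,\mathcal Y$ of the form $\begin{pmatrix}0&B\\-\bar B^T&0\end{pmatrix}$ (this does not depend on the representative $q$). A horizontal curve is an absolutely continuous curve $\gamma:[0,T]\to V_{n,k}$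 with $\dot\gamma(t)\in\mathcal H_{\gamma(t)}$ for almost every $t$; its length is $\int_0^T\sqrt{\langle\dot\gamma,\dot\gamma\rangle}\,dt$; $d(q_0,q)$ is the infimum of lengths of horizontal curves joining $q_0$ to $q$. A minimizing geodesic is a horizontal curve whose length equals the distance $d$ between its endpoints; minimizing geodesics are taken with constant-speed parametrization. Cut locus: $K_{q_0}$ is the set of points reached optimally by more than one horizontal geodesic, i.e. the set of $q$ for which there exist $T>0$ and two distinct (as curves on $[0,T]$) minimizing geodesics $\gamma_1\neq\gamma_2$ starting at $q_0$ with $\gamma_1(T)=\gamma_2(T)=q$. *)

(* Defs.v *)
(* For k <= n, n x n matrices are typed 'M_(k + (n - k)), so that they can be
   cut into blocks of sizes k and n - k. *)
From HB Require Import structures.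
From mathcomp Require Import all_boot all_order all_algebra.
From mathcomp Require Import complex.
From mathcomp Require Import all_classical all_reals all_analysis.

Set Implicit Arguments.
Unset Strict Implicit.
Unset Printing Implicit Defensive.

Import Order.TTheory GRing.Theory Num.Theory.
Import numFieldNormedType.Exports.
Local Open Scope classical_set_scope.
Local Open Scope sesquilinear_scope.
Local Open Scope ring_scope.

Definition unitary_group (R : realType) (n : nat) : set 'M[R[i]]_n :=
  [set q | q \is unitarymx].
Arguments unitary_group : clear implicits.

(* The subgroup U_n(n-k) of U(n). *)
Definition unitary_subgroup (R : realType) (n k : nat) :
    set 'M[R[i]]_(k + (n - k)) :=
  [set block_mx 1%:M 0 0 W | W in unitary_group R (n - k)].
Arguments unitary_subgroup : clear implicits.

(* The quotient V_{n,k} = U(n) / U_n(n-k) is realized as the submanifold of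
   n x k matrices X with X^* X = I_k, the class [q] being the first k columns
   of q: see pi1_image and pi1_fibre below. *)
Definition stiefel (R : realType) (n k : nat) :
    set 'M[R[i]]_(k + (n - k), k) :=
  [set X | X^t* *m X = 1%:M].
Arguments stiefel : clear implicits.

Definition pi1 (R : realType) (n k : nat) (q : 'M[R[i]]_(k + (n - k))) :
    'M[R[i]]_(k + (n - k), k) :=
  lsubmx q.
Arguments pi1 {R} n k q.

Lemma pi1_image (R : realType) (n k : nat) :
  pi1 n k @` unitary_group R (k + (n - k)) = stiefel R n k.
Proof.
apply/seteqP; split=> [_ [q + <-]|X XU]; rewrite /unitary_group/stiefel/=.
  move=> /unitarymxP/mulmx1C.
  rewrite -{2}[q]hsubmxK -{1}[q]hsubmxK tr_row_mx map_col_mx mul_col_row.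
  by rewrite scalar_mx_block => /eq_block_mx[].
have VU : X^t* \is unitarymx by apply/unitarymxP; rewrite trmxCK.
have rX : \rank (kermx X) = (n - k)%N.
  have := mxrank_unitary VU; rewrite mxrank_map mxrank_tr mxrank_ker => ->.
  by rewrite addKn.
have : exists W : 'M[R[i]]_(\rank (kermx X), k + (n - k)),
    (W \is unitarymx) /\ W *m X = 0.
  exists (schmidt (row_base (kermx X))); split.
    by apply: schmidt_unitarymx; exact: rank_leq_col.
  by apply/sub_kermxP; rewrite eqmx_schmidt_free ?eq_row_base ?row_base_free.
rewrite rX => -[W [/unitarymxP WU WX]].
have XW : X^t* *m W^t* = 0 by rewrite -map_mxM -trmx_mul WX trmx0 map_mx0.
exists ((col_mx (X^t* ) W)^t* ); last first.
  by rewrite /pi1 tr_col_mx map_row_mx row_mxKl trmxCK.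
rewrite trmxC_unitary; apply/unitarymxP.
rewrite tr_col_mx map_row_mx mul_col_row XW WU trmxCK WX XU.
by rewrite -scalar_mx_block.
Qed.

Lemma pi1_fibre (R : realType) (n k : nat) (q q' : 'M[R[i]]_(k + (n - k))) :
  unitary_group R _ q -> unitary_group R _ q' ->
  pi1 n k q = pi1 n k q' <->
  exists2 h, unitary_subgroup R n k h & q' = q *m h.
Proof.
rewrite /unitary_group/= => qU q'U; split=> [e|[_ [W /= WU <-] ->]]; last first.
  by rewrite /pi1 -[in RHS](hsubmxK q) mul_row_block row_mxKl mulmx1 mulmx0
    addr0.
have /mulmx1C qq := unitarymxP qU; have /mulmx1C qq' := unitarymxP q'U.
pose h := q^t* *m q'.
have hl : lsubmx h = col_mx 1%:M 0.
  have -> : lsubmx h = q^t* *m pi1 n k q'.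
    by rewrite /h -[q' in LHS]hsubmxK mul_mx_row row_mxKl.
  rewrite -e; have -> : q^t* *m pi1 n k q = lsubmx (q^t* *m q).
    by rewrite -[q in RHS]hsubmxK mul_mx_row row_mxKl hsubmxK.
  by rewrite qq (scalar_mx_block k (n - k) 1) block_mxEh row_mxKl.
have : h = block_mx 1%:M (usubmx (rsubmx h)) 0 (dsubmx (rsubmx h)).
  by rewrite block_mxEh vsubmxK -hl hsubmxK.
move: (usubmx _) (dsubmx _) => b d hE.
have /mulmx1C hh : h *m h^t* = 1%:M.
  by apply/unitarymxP; rewrite mul_unitarymx // trmxC_unitary.
have [b0 dd] : b = 0 /\ d^t* *m d = 1%:M.
  move: hh; rewrite hE tr_block_mx map_block_mx mulmx_block.
  rewrite trmx1 map_mx1 trmx0 map_mx0 !mul1mx !mul0mx !mulmx1 addr0.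
  rewrite (scalar_mx_block k (n - k) 1) => /eq_block_mx[_ b0 _].
  by move: b0; rewrite addr0 => ->; rewrite mulmx0 add0r.
exists h; last by rewrite mulmxA (unitarymxP qU) mul1mx.
by exists d; [apply/unitarymxP; exact: mulmx1C | rewrite hE b0].
Qed.

Definition horizontal_mx (R : realType) (n k : nat)
    (B : 'M[R[i]]_(k, n - k)) : 'M[R[i]]_(k + (n - k)) :=
  block_mx 0 B (- B^t*) 0.
Arguments horizontal_mx {R} n k B.

(* pi1 is (the restriction of) a linear map, so its differential at q sends
   the tangent vector q *m X to pi1 (q *m X). *)
Definition horizontal_space (R : realType) (n k : nat)
    (x : 'M[R[i]]_(k + (n - k), k)) : set 'M[R[i]]_(k + (n - k), k) :=
  [set v | exists q B, [/\ unitary_group R _ q, pi1 n k q = x &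
                           v = pi1 n k (q *m horizontal_mx n k B)]].
Arguments horizontal_space {R} n k x.

(* For v and w in the horizontal space at x, this is the unique real number
   -2n tr(XY) obtained from any representation v = d_q pi1 (q X),
   w = d_q pi1 (q Y) with [q] = x: see sr_inner_pi1 below. *)
Definition sr_inner (R : realType) (n k : nat)
    (x v w : 'M[R[i]]_(k + (n - k), k)) : R :=
  xget 0 [set s : R | exists q B C,
    [/\ unitary_group R _ q, pi1 n k q = x,
        v = pi1 n k (q *m horizontal_mx n k B),
        w = pi1 n k (q *m horizontal_mx n k C) &
        s%:C%C =
          - (2 * n%:R) * \tr (horizontal_mx n k B *m horizontal_mx n k C)]].
Arguments sr_inner {R} n k x v w.

Lemma sr_inner_pi1 (R : realType) (n k : nat) (q : 'M[R[i]]_(k + (n - k)))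
    (B C : 'M[R[i]]_(k, n - k)) :
  unitary_group R _ q ->
  (sr_inner n k (pi1 n k q) (pi1 n k (q *m horizontal_mx n k B))
      (pi1 n k (q *m horizontal_mx n k C)))%:C%C =
  - (2 * n%:R) * \tr (horizontal_mx n k B *m horizontal_mx n k C).
Proof.
have pi1M (p : 'M[R[i]]_(k + (n - k))) (E : 'M[R[i]]_(k, n - k)) :
    pi1 n k (p *m horizontal_mx n k E) = - (rsubmx p *m E^t* ).
  rewrite /pi1 -[p in LHS]hsubmxK mul_row_block row_mxKl mulmx0 add0r.
  by rewrite mulmxN.
have dotE (p : 'M[R[i]]_(k + (n - k))) (E F : 'M[R[i]]_(k, n - k)) :
    unitary_group R _ p ->
    (pi1 n k (p *m horizontal_mx n k E))^t* *m
      pi1 n k (p *m horizontal_mx n k F) = E *m F^t*.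
  move=> /unitarymxP/mulmx1C.
  rewrite -{2}[p]hsubmxK -{1}[p]hsubmxK tr_row_mx map_col_mx mul_col_row.
  rewrite scalar_mx_block => /eq_block_mx[_ _ _ pp].
  rewrite !pi1M mulmxN linearN/= map_mxN mulNmx opprK trmx_mul map_mxM trmxCK.
  by rewrite mulmxA -(mulmxA E) pp mulmx1.
have trE (E F : 'M[R[i]]_(k, n - k)) :
    \tr (horizontal_mx n k E *m horizontal_mx n k F) =
    - (\tr (E *m F^t* ) + (\tr (E *m F^t* ))^* ).
  rewrite mulmx_block !mul0mx !mulmx0 !add0r !addr0 mxtrace_block.
  rewrite mulmxN mulNmx !linearN/= -opprD; congr (- (_ + _)).
  by rewrite mxtrace_mulC -[in RHS]mxtrace_tr -[RHS]trace_map_mx trmx_mul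
    map_mxM trmxCK.
rewrite /sr_inner.
case: xgetP => [_ _ [p [E [F [pU _ vE wE ->]]]] qU|no qU].
  by rewrite !trE -(dotE q B C) // -(dotE p E F) // vE wE.
set x : R[i] := RHS.
have xR : x \is Num.real.
  by rewrite CrealE /x trE rmorphM !rmorphN rmorphD /= conjCK rmorphM
    !rmorph_nat addrC.
case: (no (complex.Re x)); exists q, B, C; split=> //.
exact: RRe_real.
Qed.

Definition absolutely_continuous (R : realType) (a b : R) (f : R -> R) : Prop :=
  forall e : R, 0 < e -> exists2 d : R, 0 < d &
    forall (N : nat) (u v : 'I_N -> R),
      (forall i, [/\ a <= u i, u i <= v i & v i <= b]) ->
      trivIset setT (fun i => `]u i, v i[%classic) ->
      \sum_i (v i - u i) < d -> \sum_i `|f (v i) - f (u i)| < e.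

(* Curves are total functions of a real variable; only their values on [0, T]
   matter.  Regularity and derivatives are taken on the real and imaginary
   parts of the entries. *)
Definition ac_curve (R : realType) (p q : nat) (T : R)
    (g : R -> 'M[R[i]]_(p, q)) : Prop :=
  forall i j, absolutely_continuous 0 T (fun t => complex.Re (g t i j)) /\
              absolutely_continuous 0 T (fun t => complex.Im (g t i j)).

Definition curve_derivable (R : realType) (p q : nat)
    (g : R -> 'M[R[i]]_(p, q)) (t : R) : Prop :=
  forall i j, derivable (fun s => complex.Re (g s i j) : R) t 1 /\
              derivable (fun s => complex.Im (g s i j) : R) t 1.

Definition velocity (R : realType) (p q : nat)
    (g : R -> 'M[R[i]]_(p, q)) (t : R) : 'M[R[i]]_(p, q) :=
  \matrix_(i, j) (derive1 (fun s => complex.Re (g s i j) : R) t +i*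
                    derive1 (fun s => complex.Im (g s i j) : R) t)%C.

Definition horizontal_curve (R : realType) (n k : nat) (T : R)
    (g : R -> 'M[R[i]]_(k + (n - k), k)) : Prop :=
  [/\ forall t, 0 <= t <= T -> stiefel R n k (g t),
      ac_curve T g &
      \forall t \ae (@lebesgue_measure R), 0 <= t <= T ->
        curve_derivable g t /\ horizontal_space n k (g t) (velocity g t)].
Arguments horizontal_curve {R} n k T g.

Definition speed (R : realType) (n k : nat)
    (g : R -> 'M[R[i]]_(k + (n - k), k)) (t : R) : R :=
  Num.sqrt (sr_inner n k (g t) (velocity g t) (velocity g t)).
Arguments speed {R} n k g t.

Definition curve_length (R : realType) (n k : nat) (T : R)
    (g : R -> 'M[R[i]]_(k + (n - k), k)) : \bar R :=
  (\int[lebesgue_measure]_(t in `[0%R, T]) (speed n k g t)%:E)%E.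
Arguments curve_length {R} n k T g.

Definition sr_dist (R : realType) (n k : nat)
    (x y : 'M[R[i]]_(k + (n - k), k)) : \bar R :=
  ereal_inf [set l | exists T g,
    [/\ 0 < T, horizontal_curve n k T g, g 0 = x, g T = y &
        l = curve_length n k T g]].
Arguments sr_dist {R} n k x y.

Definition minimizing_geodesic (R : realType) (n k : nat) (T : R)
    (g : R -> 'M[R[i]]_(k + (n - k), k)) : Prop :=
  [/\ horizontal_curve n k T g,
      curve_length n k T g = sr_dist n k (g 0) (g T) &
      exists c : R, \forall t \ae (@lebesgue_measure R),
        0 <= t <= T -> speed n k g t = c].
Arguments minimizing_geodesic {R} n k T g.

Definition cut_locus (R : realType) (n k : nat)
    (x : 'M[R[i]]_(k + (n - k), k)) : set 'M[R[i]]_(k + (n - k), k) :=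
  [set y | exists T g1 g2,
    [/\ 0 < T, minimizing_geodesic n k T g1, minimizing_geodesic n k T g2,
        [/\ g1 0 = x, g2 0 = x, g1 T = y & g2 T = y] &
        exists2 t, 0 <= t <= T & g1 t <> g2 t]].
Arguments cut_locus {R} n k x.

(* Main.v *)
Require Import Defs.
From mathcomp Require Import all_boot all_order all_algebra.
From mathcomp Require Import complex.
From mathcomp Require Import ring lra.
From mathcomp Require Import all_classical all_reals all_analysis.
From mathcomp Require Import measurable_realfun.

Import Order.TTheory GRing.Theory Num.Theory.
Import numFieldNormedType.Exports.
Local Open Scope classical_set_scope.
Local Open Scope ring_scope.

Set Implicit Arguments.
Unset Strict Implicit.
Unset Printing Implicit Defensive.

Import complex.

(** For k = 1 the Stiefel manifold is the unit sphere of C^n, its base point is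
    e1 = (1, 0), the horizontal vectors at x are those hermitian-orthogonal to
    x, and the sub-Riemannian speed is sqrt(4 n) times the euclidean one.

    For 0 < a < 1 and orthogonal vectors c0, c1 of squared norms 1 - a and a
    with c0 + c1 = e1, consider the horizontal curve of constant speed
      G(t) = exp(i a t) c0 + exp(- i (1 - a) t) c1,   0 <= t <= 2 pi,
    called an arc below.  It starts at e1 and ends at exp(2 i pi a) e1.

    Comparison.  Let x be a horizontal curve and tau a reparametrization of
    its time interval.  In the frame rotating with phase (a - 1/2) tau, x
    becomes u and G(tau) becomes U = exp(i tau/2) c0 + exp(- i tau/2) c1,
    which solves U'' = - U/4.  Put r = u - U and D = |r|^2.  As u and U are
    unit vectors, and ' is the derivative in tau,
      |x'|^2 - a (1 - a) = |u'|^2 - 1/4 = 2 (U'.r)' + |r'|^2 - D/4.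
    If rho solves the Riccati equation rho' = - K^2 - rho^2, then
    |r' - rho r|^2 >= 0 says that |r'|^2 >= (rho D)' + K^2 D.  So
      |x'|^2 - a (1 - a) >= h' + (K^2 - 1/4) D,   h = 2 U'.r + rho D,
    which is calibration_rate.  The solution rho = - K tan (K (tau - m)) is
    regular for tau between 0 and 2 m as long as K m < pi/2, and h vanishes
    where x = G(tau).  Two choices of K give the two halves of the theorem.

    - K < 1/2 and m = pi: integrating along a curve from G(0) to G(2 pi)
      parametrized nearly by arclength and letting K tend to 1/2 shows that
      no such curve is shorter than G (arc_lower_bound).  Hence G is
      minimizing up to time 2 pi.  Only c0 + c1 is prescribed: replacing the
      component v of c1 orthogonal to e1 by - v changes the arc and not its
      ends, so each point of the sphere on the axis C e1, except e1, is a
      cut point (axis_two_minimizers).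
    - K > 1/2 and m = t0/2 with t0 < 2 pi: a curve from e1 to G(t0) no faster
      than G has h nonincreasing with equal values at the ends, so D = 0 and
      the curve is G (arc_unique).  By disc_parametrization, an application
      of the intermediate value theorem, each point off the axis is some
      G(t0) with t0 < 2 pi, so it is not a cut point (minimizing_unique).

    At e1 itself the distance is 0 and the minimizers are constant.

    Curves are only absolutely continuous.  What is needed from the theory of
    such functions is that a nonnegative derivative almost everywhere makes
    them nondecreasing (ac_nondecreasing) and that an integrable speed has an
    absolutely continuous primitive (indefinite_integral_ac). *)

(** * Absolutely continuous functions *)

(** The closure properties below reduce to this one: the increments of the new
    function are controlled by those of functions already known to be
    absolutely continuous. *)
Lemma ac_dominated {R : realType} (a b M : R) (f g h : R -> R) :
  0 <= M -> absolutely_continuous a b f -> absolutely_continuous a b g ->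
  (forall u v, a <= u -> u <= v -> v <= b ->
    `|h v - h u| <= M * (`|f v - f u| + `|g v - g u|)) ->
  absolutely_continuous a b h.
Proof.
move=> M0 acf acg dom e e0.
have M1' : 0 < M + 1 by rewrite ltr_wpDl.
have M1 : 0 < 2 * (M + 1) by rewrite mulr_gt0.
have e'0 : 0 < e / (2 * (M + 1)) by rewrite divr_gt0.
have [d1 d10 H1] := acf _ e'0; have [d2 d20 H2] := acg _ e'0.
exists (Num.min d1 d2); first by rewrite lt_min d10.
move=> N u v uv tr; rewrite lt_min => /andP[s1 s2].
have {}H1 := H1 N u v uv tr s1; have {}H2 := H2 N u v uv tr s2.
have : \sum_i `|h (v i) - h (u i)| <= M *
   (\sum_i `|f (v i) - f (u i)| + \sum_i `|g (v i) - g (u i)|).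
  rewrite -big_split/= mulr_sumr; apply: ler_sum => i _.
  by have [? ? ?] := uv i; exact: dom.
move=> /le_lt_trans; apply.
have -> : e = (M + 1) * (e / (2 * (M + 1)) + e / (2 * (M + 1))).
  by field; apply: lt0r_neq0.
apply: (@le_lt_trans _ _ ((M + 1) * (\sum_i `|f (v i) - f (u i)| + \sum_i `|g (v i) - g (u i)|))).
  rewrite ler_wpM2r ?lerDl// addr_ge0// sumr_ge0//.
by rewrite ltr_pM2l//; apply: ltrD.
Qed.

Lemma ac_lipschitz {R : realType} (a b M : R) (f : R -> R) :
  0 <= M ->
  (forall u v, a <= u -> u <= v -> v <= b -> `|f v - f u| <= M * (v - u)) ->
  absolutely_continuous a b f.
Proof.
move=> M0 lip.
have acid : absolutely_continuous a b (@id R).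
  move=> e e0; exists e => // N u v uv _; apply: le_lt_trans.
  by apply: ler_sum => i _; rewrite ger0_norm// subr_ge0; have [] := uv i.
apply: (ac_dominated M0 acid acid) => u v au uv vb.
apply: (le_trans (lip _ _ au uv vb)); rewrite ler_wpM2l//.
by rewrite (@ger0_norm _ (v - u)) ?subr_ge0// lerDl subr_ge0.
Qed.

Lemma ac_cst {R : realType} (a b c : R) : absolutely_continuous a b (fun=> c).
Proof. by apply: (@ac_lipschitz _ _ _ 0) => // u v *; rewrite subrr normr0 mul0r. Qed.

Lemma ac_comp {R : realType} (a b lo hi M : R) (F f : R -> R) :
  0 <= M -> absolutely_continuous a b f ->
  (forall t, a <= t -> t <= b -> lo <= f t <= hi) ->
  (forall u v, lo <= u <= hi -> lo <= v <= hi -> `|F v - F u| <= M * `|v - u|) ->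
  absolutely_continuous a b (fun t => F (f t)).
Proof.
move=> M0 acf range lip.
apply: (ac_dominated M0 acf acf) => u v au uv vb.
apply: (@le_trans _ _ (M * `|f v - f u|)).
  by apply: lip; apply: range => //; lra.
by rewrite ler_wpM2l// lerDl.
Qed.

Lemma ac_add {R : realType} (a b : R) (f g : R -> R) :
  absolutely_continuous a b f -> absolutely_continuous a b g ->
  absolutely_continuous a b (fun t => f t + g t).
Proof.
move=> acf acg; apply: (ac_dominated ler01 acf acg) => u v au uv vb.
by rewrite mul1r opprD addrACA ler_normD.
Qed.

Lemma ac_scale {R : realType} (a b k : R) (f : R -> R) :
  absolutely_continuous a b f -> absolutely_continuous a b (fun t => k * f t).
Proof.
move=> acf; apply: (ac_dominated (normr_ge0 k) acf acf) => u v *.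
by rewrite -mulrBr normrM ler_wpM2l// lerDl.
Qed.

Lemma ac_opp {R : realType} (a b : R) (f : R -> R) :
  absolutely_continuous a b f -> absolutely_continuous a b (fun t => - f t).
Proof.
move=> acf; rewrite (_ : (fun _ => _) = (fun t => -1 * f t)).
  exact: ac_scale.
by apply/funext => t; rewrite mulN1r.
Qed.

Lemma ac_sub {R : realType} (a b : R) (f g : R -> R) :
  absolutely_continuous a b f -> absolutely_continuous a b g ->
  absolutely_continuous a b (fun t => f t - g t).
Proof. by move=> acf acg; apply: ac_add => //; exact: ac_opp. Qed.

Lemma ac_sum {R : realType} (a b : R) (I : Type) (r : seq I) (f : I -> R -> R) :
  (forall i, absolutely_continuous a b (f i)) ->
  absolutely_continuous a b (fun t => \sum_(i <- r) f i t).
Proof.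
move=> acf; elim: r => [|i r IH].
  rewrite (_ : (fun _ => _) = (fun=> 0)); first exact: ac_cst.
  by apply/funext => t; rewrite big_nil.
rewrite (_ : (fun _ => _) = (fun t => f i t + \sum_(i <- r) f i t)).
  exact: ac_add.
by apply/funext => t; rewrite big_cons.
Qed.

Lemma ac_subitv {R : realType} (a b c d : R) (f : R -> R) : a <= c -> d <= b ->
  absolutely_continuous a b f -> absolutely_continuous c d f.
Proof.
move=> ac db acf e /acf[dl dl0 H]; exists dl => // N u v uv.
apply: H => i; have [cu uv' vd] := uv i.
by split=> //; [exact: le_trans cu|exact: le_trans vd _].
Qed.

Lemma ac_close {R : realType} (a b e : R) (f : R -> R) :
  absolutely_continuous a b f -> 0 < e ->
  exists2 d, 0 < d & forall u v, a <= u <= b -> a <= v <= b -> `|u - v| < d ->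
    `|f u - f v| < e.
Proof.
move=> acf e0; have [d d0 H] := acf _ e0; exists d => //.
have key u v : a <= u -> u <= v -> v <= b -> v - u < d -> `|f v - f u| < e.
  move=> au uv vb uvd.
  have := H 1%N (fun=> u) (fun=> v); rewrite !big_ord1; apply => //.
  by apply/trivIsetP => i j _ _; rewrite (ord1 i) (ord1 j) eqxx.
move=> u v /andP[au ub] /andP[av vb].
have [uv|/ltW vu] := leP u v.
  by rewrite distrC (distrC (f u)) ger0_norm ?subr_ge0//; exact: key.
by rewrite ger0_norm ?subr_ge0//; exact: key.
Qed.

(** Regularity is only known on [a, b], while the extreme value theorem and the
    measurability of continuous functions are used for total functions; the
    constant extension beyond the ends bridges the gap. *)
Definition clamp {R : realType} (a b : R) (f : R -> R) (t : R) : R :=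
  f (Num.max a (Num.min t b)).

Lemma clamp_id {R : realType} (a b : R) (f : R -> R) t :
  a <= t <= b -> clamp a b f t = f t.
Proof.
by case/andP=> at' tb; rewrite /clamp (min_idPl tb) (max_idPr at').
Qed.

Lemma ac_clamp_continuous {R : realType} (a b : R) (f : R -> R) :
  a <= b -> absolutely_continuous a b f -> continuous (clamp a b f).
Proof.
move=> ab acf t; apply/cvgrPdist_lt => e e0.
have [d d0 H] := ac_close acf e0.
have rng s : a <= Num.max a (Num.min s b) <= b.
  by rewrite le_max lexx/= ge_max ab/= ge_min lexx orbT.
near=> s; apply: H => //.
apply: (@le_lt_trans _ _ `|t - s|); last first.
  by near: s; apply: (@cvgr_dist_lt _ _ _ (nbhs t)) => //; exact: cvg_id.
rewrite /Num.max /Num.min; do ! case: ifPn; rewrite -?leNgt => *;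
 rewrite ler_norml !(ler_norm, ler_normr, lerBlDl);
 have := ler_norm (t - s); have := ler_norm (s - t); rewrite (distrC s); lra.
Unshelve. all: by end_near. Qed.

Lemma ac_bounded {R : realType} (a b : R) (f : R -> R) :
  a <= b -> absolutely_continuous a b f ->
  exists2 M, 0 <= M & forall t, a <= t -> t <= b -> `|f t| <= M.
Proof.
move=> ab acf; have cf := ac_clamp_continuous ab acf.
have [c _ Hc] := EVT_max ab (continuous_subspaceT cf).
have [c' _ Hc'] := EVT_min ab (continuous_subspaceT cf).
exists (`|clamp a b f c| + `|clamp a b f c'|); first by rewrite addr_ge0.
move=> t at' tb; have tab : t \in `[a, b] by rewrite in_itv/= at'.
have := Hc _ tab; have := Hc' _ tab; rewrite (@clamp_id _ a b f t) ?at'// => h1 h2.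
rewrite ler_norml; have := ler_norm (clamp a b f c).
have := ler_norm (- clamp a b f c'); rewrite normrN.
have := normr_ge0 (clamp a b f c); have := normr_ge0 (clamp a b f c'); lra.
Qed.

Lemma ac_mul {R : realType} (a b : R) (f g : R -> R) : a <= b ->
  absolutely_continuous a b f -> absolutely_continuous a b g ->
  absolutely_continuous a b (fun t => f t * g t).
Proof.
move=> ab acf acg.
have [M M0 Mf] := ac_bounded ab acf.
have [N N0 Ng] := ac_bounded ab acg.
apply: (ac_dominated (addr_ge0 M0 N0) acf acg) => u v au uv vb.
have -> : f v * g v - f u * g u = f v * (g v - g u) + g u * (f v - f u) by ring.
rewrite (le_trans (ler_normD _ _))// !normrM.
have h1 : `|f v| * `|g v - g u| <= M * `|g v - g u|.
  by rewrite ler_wpM2r// Mf//; lra.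
have h2 : `|g u| * `|f v - f u| <= N * `|f v - f u|.
  by rewrite ler_wpM2r// Ng//; lra.
rewrite (le_trans (lerD h1 h2))// -subr_ge0.
have -> : (M + N) * (`|f v - f u| + `|g v - g u|) - (M * `|g v - g u| + N * `|f v - f u|)
  = M * `|f v - f u| + N * `|g v - g u| by ring.
by rewrite addr_ge0// mulr_ge0.
Qed.

Lemma lipschitz_of_derivative {R : realType} (lo hi M : R) (F dF : R -> R) :
  (forall x, lo <= x <= hi -> is_derive x 1 F (dF x)) ->
  (forall x, lo <= x <= hi -> `|dF x| <= M) ->
  forall u v, lo <= u <= hi -> lo <= v <= hi -> `|F v - F u| <= M * `|v - u|.
Proof.
move=> dFE bnd.
have key u v : lo <= u <= hi -> lo <= v <= hi -> u < v -> `|F v - F u| <= M * `|v - u|.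
  move=> ur vr uv.
  have dd x : x \in `]u, v[ -> is_derive x 1 F (dF x).
    by rewrite in_itv/= => xuv; apply: dFE; lra.
  have cc : {within `[u, v], continuous F}.
    apply: derivable_within_continuous => x; rewrite in_itv/= => xuv.
    by apply: @ex_derive; apply: dFE; lra.
  have [c cuv ->] := MVT uv dd cc.
  rewrite normrM ler_wpM2r// bnd//.
  by move: cuv; rewrite in_itv/=; lra.
move=> u v ur vr; have [uv|vu|->] := ltgtP u v; first exact: key.
  by rewrite distrC (distrC v); exact: key.
by rewrite !subrr normr0 mulr0.
Qed.

(** * Monotonicity from the sign of the derivative *)

Lemma ae_imp {R : realType} (P Q : R -> Prop) : (forall t, P t -> Q t) ->
  {ae lebesgue_measure, forall t : R, P t} -> {ae lebesgue_measure, forall t : R, Q t}.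
Proof.
by move=> PQ; apply: filterS => //; exact: (ae_filter_ringOfSetsType lebesgue_measure).
Qed.

Lemma ae_and {R : realType} (P Q : R -> Prop) :
  {ae lebesgue_measure, forall t : R, P t} -> {ae lebesgue_measure, forall t : R, Q t} ->
  {ae lebesgue_measure, forall t : R, P t /\ Q t}.
Proof.
by move=> aP aQ; apply: filterI => //; exact: (ae_filter_ringOfSetsType lebesgue_measure).
Qed.

(** Two-sided form, as the real induction in ac_nondecreasing needs the step
    that arrives at t as well as the step that leaves t. *)
Lemma derivable_ge0_local {R : realType} (h : R -> R) (t e : R) :
  derivable h t 1 -> 0 <= derive1 h t -> 0 < e ->
  exists2 d, 0 < d & forall r, `|r - t| < d ->
    (r <= t -> h r <= h t + e * (t - r)) /\ (t <= r -> h t <= h r + e * (r - t)).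
Proof.
move=> dh h0 e0.
have dE : (fun k => k^-1 *: ((h \o shift t) (k *: 1%R) - h t)) @ 0^' --> derive1 h t.
  by rewrite derive1E; exact: dh.
have /cvgrPdist_lt /(_ e e0) := dE.
rewrite /prop_near1 /nbhs /= /dnbhs /within /= => -[d d0 Hd].
exists d => // r rd.
have [->|rt] := eqVneq r t; first by rewrite subrr mulr0 addr0.
have rt0 : r - t != 0 by rewrite subr_eq0.
have := Hd (r - t); rewrite /ball_/= sub0r normrN => /(_ rd rt0).
rewrite [(r - t) *: _]mulr1 subrK.
set q := _ *: _ => Hq.
have qE : h r - h t = q * (r - t) by rewrite /q [_ *: _]mulrC mulfVK.
have q_gt : - e < q by have := ler_norm (derive1 h t - q); lra.
split=> rt'.
  have : 0 <= (q + e) * (t - r) by rewrite mulr_ge0//; lra.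
  by lra.
have : 0 <= (q + e) * (r - t) by rewrite mulr_ge0//; lra.
by lra.
Qed.

Lemma measure_disjoint_intervals {R : realType} (N : nat) (u v : 'I_N -> R) :
  (forall i, u i <= v i) -> trivIset setT (fun i => `]u i, v i[%classic) ->
  lebesgue_measure (\big[setU/set0]_(i < N) `]u i, v i[%classic) =
    (\sum_i (v i - u i))%:E.
Proof.
move=> uv tr.
have mI (i : 'I_N) : measurable (`]u i, v i[%classic : set R).
  exact: measurable_itv.
rewrite [LHS](@measure_bigsetU_ord _ _ _ (@lebesgue_measure R) N predT _ mI tr).
rewrite -sumEFin; apply: eq_bigr => i _.
transitivity (lebesgue_measure (`]u i, v i[%classic : set R)) => //.
rewrite lebesgue_measure_itv/= lte_fin.
have [//|] := ltP; move: (uv i) => h1 h2.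
by rewrite (le_anti (y := v i) (x := u i)) ?h1// subrr.
Qed.

Lemma sum_disjoint_subintervals {R : realType} (O : set R) (d : R) (N : nat)
    (u v : 'I_N -> R) :
  open O -> (lebesgue_measure O < d%:E)%E ->
  (forall i, u i <= v i) -> (forall i, `]u i, v i[%classic `<=` O) ->
  trivIset setT (fun i => `]u i, v i[%classic) ->
  \sum_i (v i - u i) < d.
Proof.
move=> oO mO uv uvO tr; rewrite -lte_fin; apply: le_lt_trans mO.
rewrite -(measure_disjoint_intervals uv tr); apply: le_measure; rewrite ?inE//.
- by apply: bigsetU_measurable => i _; exact: measurable_itv.
- exact: open_measurable.
- apply: (big_ind (fun X => X `<=` O)) => // X Y XO YO.
  by rewrite subUset.
Qed.

(** This replaces the fundamental theorem of calculus.  Fix e > 0 and cover the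
    exceptional null set by an open set O of measure less than the modulus of
    absolute continuity of h for e.  Walk from a to b: near a good point h
    decreases with slope at most e, and a step inside O costs the absolute
    increment of h on it.  The steps inside O are disjoint intervals of total
    length less than the modulus, so their total cost is less than e. *)
Lemma ac_nondecreasing {R : realType} (a b : R) (h : R -> R) : a <= b ->
  absolutely_continuous a b h ->
  {ae lebesgue_measure, forall t : R, a < t < b ->
     derivable h t 1 /\ 0 <= derive1 h t} ->
  h a <= h b.
Proof.
move=> ab ach [Z [mZ Z0 badZ]].
suff key e : 0 < e -> h a <= h b + e + e * (b - a).
  apply/ler_addgt0Pr => e e0.
  have ba : 0 < 1 + (b - a) by rewrite ltr_wpDr// subr_ge0.
  have := key _ (divr_gt0 e0 ba); rewrite -addrA -{1}[e / _]mulr1 -mulrDr.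
  by rewrite divfK ?gt_eqF.
move=> e0; have [d d0 acd] := ach _ e0.
(* At the end points no information on the derivative is available: they are
   put in the exceptional set. *)
pose Z' := Z `|` [set a; b].
have mab : measurable ([set a; b] : set R).
  by apply: measurableU; exact: measurable_set1.
have mZ' : measurable Z' by exact: measurableU.
have ab0 : lebesgue_measure ([set a; b] : set R) = 0%E.
  by rewrite [LHS]null_set_setU//; exact: lebesgue_measure_set1.
have Z'0 : lebesgue_measure Z' = 0%E by rewrite [LHS]null_set_setU.
have [|O [oO ZO OZ]] := @lebesgue_regularity_outer _ Z' d mZ' _ d0.
  by rewrite [X in (X < _)%E]Z'0 ltry.
have mO : (lebesgue_measure O < d%:E)%E.
  rewrite -(setDUK ZO) measureU//; last 2 first.
  - by apply: measurableD => //; exact: open_measurable.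
  - by rewrite setDIK.
  by rewrite [X in (X + _)%E]Z'0 add0e.
(* A walk from a to t: its steps inside O are the intervals ]u i, v i[, listed
   from left to right, which makes them disjoint. *)
pose fam (t : R) (N : nat) (u v : nat -> R) := [/\
  forall i, (i < N)%N -> [/\ a <= u i, u i <= v i & v i <= t],
  forall i j, (i < j < N)%N -> v i <= u j,
  forall i, (i < N)%N -> `]u i, v i[%classic `<=` O &
  h a <= h t + \sum_(i < N) `|h (v i) - h (u i)| + e * (t - a)].
pose P t := exists N u v, fam t N u v.
have Pa : P a by exists 0%N, (fun=> a), (fun=> a); split=> //; rewrite big_ord0 subrr; lra.
have good1 x y : a <= x -> x <= y -> h x <= h y + e * (y - x) -> P x -> P y.
  move=> ax xy hxy [N [u [v [A B C D]]]]; exists N, u, v; split=> //.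
    by move=> i /A[? ? vx]; split=> //; exact: le_trans xy.
  by lra.
have good2 x y : a <= x -> x <= y -> `]x, y[%classic `<=` O -> P x -> P y.
  move=> ax xy xyO [N [u [v [A B C D]]]].
  exists N.+1, (fun i => if (i < N)%N then u i else x),
    (fun i => if (i < N)%N then v i else y); split.
  - move=> i _; case: ifPn => // /A[? ? vx]; split=> //; exact: le_trans xy.
  - move=> i j; rewrite ltnS => /andP[ij jN].
    rewrite (leq_trans ij jN); case: ifPn => jN'; first by rewrite B ?ij.
    by have [] := A i (leq_trans ij jN).
  - by move=> i _; case: ifPn => // /C.
  - rewrite big_ord_recr/= ltnn.
    under eq_bigr do rewrite ltn_ord.
    have := ler_norm (h x - h y); rewrite distrC.
    have : 0 <= e * (y - x) by rewrite mulr_ge0 ?subr_ge0// ltW.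
    by lra.
have local t : a <= t <= b -> exists2 r, 0 < r & forall s, `|s - t| < r ->
    a <= s <= b -> (s <= t -> P s -> P t) /\ (t <= s -> P t -> P s).
  move=> /andP[at' tb]; have [tO|tO] := pselect (O t).
    have [r r0 tr] : exists2 r : R, 0 < r & ball t r `<=` O.
      have /nbhs_ballP[r /= r0 Hr] : nbhs t O by exact: open_nbhs_nbhs.
      by exists r.
    exists r => // s; rewrite ltr_norml => /andP[s1 s2] /andP[as' sb].
    split=> st; apply: good2 => // w /=; rewrite in_itv/= => /andP[w1 w2];
      apply: tr; rewrite /ball/= ltr_norml; lra.
  have [tZ' tat] : ~ Z t /\ a < t < b.
    split; first by move=> zt; apply: tO; apply: ZO; left.
    rewrite !lt_neqAle at' tb !andbT.
    apply/andP; split; apply/eqP => E; apply: tO; apply: ZO; right;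
     by [left; rewrite E|right; rewrite E].
  have [dt h0] : derivable h t 1 /\ 0 <= derive1 h t.
    by apply: contrapT => H; apply: tZ'; apply: badZ => /= /(_ tat).
  have [r r0 Hr] := derivable_ge0_local dt h0 e0; exists r => // s st /andP[as' sb].
  have [H1 H2] := Hr _ st; split=> ord; apply: good1 => //; [exact: H1|exact: H2].
(* Real induction: the supremum s of the reachable times is reachable, and a
   step beyond s is possible unless s = b. *)
pose S := [set t | a <= t <= b /\ P t].
have S0 : S !=set0 by exists a; split=> //; rewrite lexx.
have ubS : ubound S b by move=> t [/andP[]].
have hsS : has_sup S by split=> //; exists b.
pose s := sup S.
have sab : a <= s <= b.
  apply/andP; split; last by apply: ge_sup.
  by apply: ub_le_sup; [exists b|split=> //; rewrite lexx].
have [r r0 Hr] := local s sab.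
have Ps : P s.
  have [t [tab Pt] tr] := sup_adherent r0 hsS.
  have ts : t <= s by apply: ub_le_sup; [exists b|split].
  have [|H1 _] := Hr t _ tab; last exact: H1.
  by rewrite -/s in tr *; rewrite ler0_norm; lra.
have sb : s = b.
  apply/eqP; rewrite eq_le; case/andP: (sab) => as' -> /=; rewrite leNgt.
  apply/negP => sb; pose t := Num.min b (s + r / 2).
  have st : s < t by rewrite lt_min sb/= ltrDl divr_gt0.
  have tb : t <= b by rewrite ge_min lexx.
  have tr : t <= s + r / 2 by rewrite ge_min lexx orbT.
  have tab : a <= t <= b by rewrite tb andbT (le_trans as')// ltW.
  have [|_ H2] := Hr t _ tab; first by rewrite gtr0_norm ?subr_gt0//; lra.
  have : t <= s by apply: ub_le_sup; [exists b|split=> //; apply: H2 => //; exact: ltW].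
  by rewrite leNgt st.
move: Ps; rewrite sb => -[N [u [v [A B C D]]]].
have tr : trivIset setT (fun i : 'I_N => `]u i, v i[%classic).
  apply/trivIsetP => i j _ _ ij.
  wlog lij : i j ij / (i < j)%N.
    move=> W; have /orP[l|l] : (i < j)%N || (j < i)%N by rewrite -neq_ltn.
      exact: W.
    by rewrite setIC; apply: W => //; rewrite eq_sym.
  apply/seteqP; split=> // x [/=]; rewrite !in_itv/= => /andP[_ x1] /andP[x2 _].
  have := B i j; rewrite lij ltn_ord => /(_ isT) vu.
  by have := lt_trans x2 (lt_le_trans x1 vu); rewrite ltxx.
have uvi (i : 'I_N) : [/\ a <= u i, u i <= v i & v i <= b] by exact: A.
have small : \sum_(i < N) (v i - u i) < d.
  apply: sum_disjoint_subintervals oO mO _ _ tr => i; last exact: C.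
  by have [] := uvi i.
have := acd N _ _ uvi tr small; lra.
Qed.

(** A null set contains no interval, so the zeros are dense. *)
Lemma ac_ae_zero {R : realType} (T : R) (f : R -> R) : 0 < T ->
  absolutely_continuous 0 T f ->
  {ae lebesgue_measure, forall t : R, 0 < t < T -> f t = 0} ->
  forall t, 0 <= t <= T -> f t = 0.
Proof.
move=> T0 acf [Z [mZ Z0 badZ]] t tT; apply/eqP; rewrite -normr_le0.
apply/ler_addgt0Pr => e e0; rewrite add0r.
have [d d0 close] := ac_close acf e0.
pose x := Num.max 0 (t - d); pose y := Num.min T (t + d).
have xy : x < y by rewrite /x /y lt_min !gt_max T0/=; lra.
have [s sxy sZ] : exists2 s, x < s < y & ~ Z s.
  apply: contrapT => noS.
  have sub : `]x, y[%classic `<=` Z.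
    move=> s /=; rewrite in_itv/= => sxy; apply: contrapT => Zs.
    by apply: noS; exists s.
  have : (lebesgue_measure (`]x, y[%classic : set R) <= lebesgue_measure Z)%E.
    by apply: le_measure => //; rewrite inE//; exact: measurable_itv.
  rewrite lebesgue_measure_itv/= lte_fin xy [X in (_ <= X)%E -> _]Z0.
  by rewrite -EFinB lee_fin subr_le0 leNgt xy.
have [x0 xt] : 0 <= x /\ t - d <= x by rewrite /x !le_max !lexx orbT.
have [yT yt] : y <= T /\ y <= t + d by rewrite /y !ge_min !lexx orbT.
have sT : 0 < s < T by case/andP: sxy => *; apply/andP; split; lra.
have fs0 : f s = 0.
  by apply: contrapT => fs; apply: sZ; apply: badZ => /= /(_ sT).
have := close t s; rewrite fs0 subr0 => /(_ tT) H; apply/ltW/H; first lra.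
by rewrite ltr_norml; case/andP: sxy => *; apply/andP; split; lra.
Qed.

(** * Indefinite integrals and measurability of derivatives *)

Import HBNNSimple.

(** Monotonicity of the integral without measurability: the speed of a curve is
    known only almost everywhere and need not be measurable, but the integral
    of a nonnegative function is a supremum over simple functions, which can
    be cut off on a null set. *)
Lemma ge0_le_integral_negligible {R : realType} (D N : set R)
    (f g : R -> \bar R) : measurable N -> lebesgue_measure N = 0%E ->
  (forall t, D t -> (0 <= f t)%E) -> (forall t, D t -> (0 <= g t)%E) ->
  (forall t, D t -> ~ N t -> (f t <= g t)%E) ->
  (\int[lebesgue_measure]_(t in D) f t <= \int[lebesgue_measure]_(t in D) g t)%E.
Proof.
move=> mN N0 f0 g0 fg; rewrite !ge0_integralE//.
apply: ge_ereal_sup => _ [h /= hf <-].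
pose k := proj_nnsfun h (measurableC mN).
have kE t : k t = h t * \1_(~` N) t by rewrite /k /= mindicE.
have -> : sintegral lebesgue_measure h = sintegral lebesgue_measure k.
  rewrite -!integralT_nnsfun.
  apply: ge0_ae_eq_integral => //.
  - exact/measurable_EFinP.
  - exact/measurable_EFinP.
  - by move=> t _; rewrite lee_fin.
  - by move=> t _; rewrite lee_fin.
  - exists N; split=> // t /= /not_implyP[_] hk; apply: contrapT => Nt.
    by apply: hk; rewrite mindicE mem_set// mulr1.
apply: ereal_sup_ubound; exists k => // t.
rewrite kE indicE; have := hf t; rewrite !patchE.
case: ifPn => [/set_mem Dt|Dt] ht.
  have [Nt|Nt] := boolP (t \in ~` N); last by rewrite mulr0 g0.
  by rewrite mulr1 (le_trans ht)// fg//; move: Nt; rewrite inE.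
by apply: le_trans ht; rewrite lee_fin ler_piMr//; case: (_ \in _).
Qed.

(** On a set of points of derivability the derivative is the limit of the
    difference quotients with steps 1/(k+1) of a continuous function. *)
Lemma measurable_derivative {R : realType} (a b : R) (f : R -> R) (G : set R) :
  a <= b -> absolutely_continuous a b f -> measurable G ->
  (forall t, G t -> a < t < b /\ derivable f t 1) ->
  measurable_fun G (derive1 f).
Proof.
move=> ab acf mG GP; have cf := ac_clamp_continuous ab acf.
pose q (k : nat) t := k.+1%:R * (clamp a b f (t + k.+1%:R^-1) - clamp a b f t).
apply: (@measurable_fun_cvg _ _ _ G q).
  move=> k; apply: measurable_funTS; apply: measurable_funM => //.
  apply: measurable_funB; apply: continuous_measurable_fun => //.
  move=> t; apply: continuous_comp; last exact: cf.
  by apply: cvgD; [exact: cvg_id|exact: cvg_cst].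
move=> t Gt; have [/andP[at' tb] dft] := GP t Gt.
have dE : (fun k => k^-1 *: ((f \o shift t) (k *: 1%R) - f t)) @ 0^' --> derive1 f t.
  by rewrite derive1E; exact: dft.
have /cvgr_dnbhsP /(_ (fun k => k.+1%:R^-1)) := dE.
have inv_cvg : (forall k : nat, (k.+1%:R^-1 : R) != 0) /\
    (fun k : nat => k.+1%:R^-1 : R) @ \oo --> 0.
  by split; [move=> k; rewrite invr_eq0 pnatr_eq0|exact: cvg_harmonic].
move=> /(_ inv_cvg).
apply: cvg_trans; apply: near_eq_cvg.
have tb0 : 0 < b - t by rewrite subr_gt0.
near=> k; rewrite /q /= invrK [_ *: 1]mulr1 (addrC _ t).
have kb : k.+1%:R^-1 < b - t.
  near: k; have /cvgrPdist_lt/(_ _ tb0) := @cvg_harmonic R.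
  apply: filterS => k; rewrite sub0r normrN; apply: le_lt_trans.
  exact: ler_norm.
have k0 : 0 < k.+1%:R^-1 :> R by rewrite invr_gt0.
by move: (k.+1%:R^-1) k0 kb => z z0 zb; rewrite !clamp_id//; apply/andP; split; lra.
Unshelve. all: by end_near. Qed.

(** Absolute continuity of the primitive is that of the integral as a set
    function; its derivative comes from the Lebesgue differentiation
    theorem. *)
Lemma indefinite_integral_ac {R : realType} (T : R) (w : R -> R) : 0 <= T ->
  (forall t, 0 <= w t) -> (forall t, ~ (0 < t < T) -> w t = 0) ->
  lebesgue_measure.-integrable setT (EFin \o w) ->
  exists S : R -> R, [/\ absolutely_continuous 0 T S, S 0 = 0,
    (S T)%:E = (\int[lebesgue_measure]_(t in `[0%R, T]) (w t)%:E)%E,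
    forall u v, u <= v -> S u <= S v &
    {ae lebesgue_measure, forall t, derivable S t 1 /\ derive1 S t = w t}].
Proof.
move=> T0 w0 wout iw.
pose S (t : R) : R := (\int[lebesgue_measure]_(x in `]-oo, t]) w x)%R.
have iwS (A : set R) : measurable A -> lebesgue_measure.-integrable A (EFin \o w).
  by move=> mA; apply: integrableS iw.
have SB (u v : R) : u <= v ->
    S v - S u = (\int[lebesgue_measure]_(x in `]u, v]) w x)%R.
  by move=> uv; rewrite /S Rintegral_itvB//; exact: iwS.
have Smono u v : u <= v -> S u <= S v.
  by move=> uv; rewrite -subr_ge0 SB//; exact: Rintegral_ge0.
have SBo (u v : R) : u <= v ->
    S v - S u = (\int[lebesgue_measure]_(x in `]u, v[) w x)%R.
  by move=> uv; rewrite SB// Rintegral_itv_bndo_bndc//; exact: iwS.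
have S0 : S 0 = 0.
  rewrite /S /Rintegral integral0_eq// => x /=; rewrite in_itv/= => x0.
  by rewrite wout// => /andP[x0' _]; lra.
exists S; split=> //.
- move=> e e0; have [d [d0 Hd]] := integral_normr_continuous iw e0.
  exists d => // N u v uv tr small.
  have uvi i : u i <= v i by have [] := uv i.
  have mI (i : 'I_N) : measurable (`]u i, v i[%classic : set R).
    exact: measurable_itv.
  pose U := \big[setU/set0]_(i < N) `]u i, v i[%classic.
  have mU : measurable U by exact: bigsetU_measurable.
  have muU : (lebesgue_measure U < d%:E)%E.
    by rewrite [X in (X < _)%E](measure_disjoint_intervals uvi tr) lte_fin.
  have := Hd U mU muU; congr (_ < e).
  have -> : (\int[lebesgue_measure]_(x in U) `|w x|)%R = (\int[lebesgue_measure]_(x in U) w x)%R.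
    by apply: eq_Rintegral => x _; rewrite ger0_norm.
  apply: EFin_inj; rewrite /Rintegral fineK; last first.
    by apply: integrable_fin_num => //; exact: iwS.
  rewrite -[LHS]/(\int[lebesgue_measure]_(x in U) (w x)%:E)%E /U.
  rewrite integral_bigsetU_EFin//; last 3 first.
  - exact: index_enum_uniq.
  - exact: sub_trivIset tr.
  - by apply: measurable_funTS; case/integrableP: iw.
  rewrite -sumEFin; apply: eq_bigr => i _.
  rewrite ger0_norm; last by rewrite subr_ge0; exact: Smono.
  rewrite SBo// fineK//; apply: integrable_fin_num => //; exact: iwS.
- have -> : S T = S T - S 0 by rewrite S0 subr0.
  rewrite SB// Rintegral_itv_obnd_cbnd; last exact: iwS.
  by rewrite /Rintegral fineK//; apply: integrable_fin_num => //; exact: iwS.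
- apply: FTC1Ny; first by move=> y; exact: iwS.
  by apply: open_integrable_locally => //; exact: openT.
Qed.

(** * Hermitian geometry of the sphere *)

Section Hermitian.
Local Open Scope sesquilinear_scope.
Context {R : realType} {m : nat}.
Implicit Types (u w x v c : 'cV[R[i]]_m).

(** The hermitian product is kept as two real numbers, its real part rdot and
    its imaginary part idot, because derivatives of curves are taken on real
    and imaginary parts. *)
Definition rdot u w : R :=
  \sum_j (Re (u j 0) * Re (w j 0) + Im (u j 0) * Im (w j 0)).

Definition idot u w : R :=
  \sum_j (Re (u j 0) * Im (w j 0) - Im (u j 0) * Re (w j 0)).

Lemma hermitian_mxE u w : u^t* *m w = (rdot u w +i* idot u w)%C%:M.
Proof.
apply/matrixP => i j; rewrite !ord1 mxE mxE eqxx mulr1n /rdot /idot.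
have -> : ((\sum_j (Re (u j 0) * Re (w j 0) + Im (u j 0) * Im (w j 0))) +i*
   (\sum_j (Re (u j 0) * Im (w j 0) - Im (u j 0) * Re (w j 0))))%C =
  \sum_j ((Re (u j 0) * Re (w j 0) + Im (u j 0) * Im (w j 0)) +i*
     (Re (u j 0) * Im (w j 0) - Im (u j 0) * Re (w j 0)))%C.
  by elim/big_rec3: _ => //= k a b c _ <-.
apply: eq_bigr => k _; rewrite !mxE.
case: (u k 0) (w k 0) => [a b] [c d].
by rewrite /=; apply/eqP; rewrite eq_complex /=; apply/andP; split; apply/eqP; ring.
Qed.

Lemma rdotC u w : rdot u w = rdot w u.
Proof. by apply: eq_bigr => j _; rewrite mulrC [X in _ + X]mulrC. Qed.

Lemma idotC u w : idot u w = - idot w u.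
Proof. by rewrite /idot -sumrN; apply: eq_bigr => j _; ring. Qed.

Lemma idot_self u : idot u u = 0.
Proof. by apply: big1 => j _; ring. Qed.

Lemma rdotD u w x : rdot u (w + x) = rdot u w + rdot u x.
Proof.
rewrite /rdot -big_split; apply: eq_bigr => j _ /=; rewrite mxE.
by case: (u j 0) (w j 0) (x j 0) => [? ?] [? ?] [? ?] /=; ring.
Qed.

Lemma idotD u w x : idot u (w + x) = idot u w + idot u x.
Proof.
rewrite /idot -big_split; apply: eq_bigr => j _ /=; rewrite mxE.
by case: (u j 0) (w j 0) (x j 0) => [? ?] [? ?] [? ?] /=; ring.
Qed.

Lemma rdotN u w : rdot u (- w) = - rdot u w.
Proof.
rewrite /rdot -sumrN; apply: eq_bigr => j _ /=; rewrite mxE.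
by case: (u j 0) (w j 0) => [? ?] [? ?] /=; ring.
Qed.

Lemma rdotZ u (a b : R) w : rdot u ((a +i* b)%C *: w) = a * rdot u w - b * idot u w.
Proof.
rewrite /rdot /idot !mulr_sumr -sumrB; apply: eq_bigr => j _ /=; rewrite mxE.
by case: (u j 0) (w j 0) => [? ?] [? ?] /=; ring.
Qed.

Lemma idotZ u (a b : R) w : idot u ((a +i* b)%C *: w) = a * idot u w + b * rdot u w.
Proof.
rewrite /rdot /idot !mulr_sumr -big_split; apply: eq_bigr => j _ /=; rewrite mxE.
by case: (u j 0) (w j 0) => [? ?] [? ?] /=; ring.
Qed.

Lemma rdot_ge0 u : 0 <= rdot u u.
Proof. by apply: sumr_ge0 => j _; rewrite addr_ge0// -expr2 sqr_ge0. Qed.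

Lemma rdot_eq0 u : rdot u u = 0 -> u = 0.
Proof.
move=> u0; apply/matrixP => j k; rewrite ord1 mxE.
have ge0 (i : 'I_m) : true -> 0 <= Re (u i 0) * Re (u i 0) + Im (u i 0) * Im (u i 0).
  by move=> _; rewrite addr_ge0// -expr2 sqr_ge0.
have := psumr_eq0P ge0 u0 (i := j) isT; case: (u j 0) => a b /= /eqP.
by rewrite paddr_eq0 -?expr2 ?sqr_ge0// !sqrf_eq0 => /andP[/eqP-> /eqP->].
Qed.

Lemma rdotDl u w x : rdot (u + w) x = rdot u x + rdot w x.
Proof. by rewrite ![rdot _ x]rdotC rdotD. Qed.

Lemma idotDl u w x : idot (u + w) x = idot u x + idot w x.
Proof. by rewrite ![idot _ x]idotC idotD opprD. Qed.

Lemma rdotNl u w : rdot (- u) w = - rdot u w.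
Proof. by rewrite ![rdot _ w]rdotC rdotN. Qed.

Lemma rdotZl (a b : R) u w : rdot ((a +i* b)%C *: u) w = a * rdot u w + b * idot u w.
Proof. by rewrite ![rdot _ w]rdotC rdotZ [idot w u]idotC mulrN opprK. Qed.

Lemma idotZl (a b : R) u w : idot ((a +i* b)%C *: u) w = a * idot u w - b * rdot u w.
Proof. by rewrite ![idot _ w]idotC idotZ [rdot w u]rdotC; ring. Qed.

Definition dotE := (rdotD, idotD, rdotZ, idotZ, rdotN, rdotDl, idotDl, rdotZl, idotZl, rdotNl).

(** The squared norm of v + A x + B c0 + C c1, for complex numbers A, B, C. *)
Lemma gram_ge0 x v c0 c1 (A1 A2 B1 B2 C1 C2 : R) :
  rdot x x = 1 -> rdot x v = 0 -> idot x v = 0 -> rdot c0 c1 = 0 -> idot c0 c1 = 0 ->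
  0 <= rdot v v + (A1 ^+ 2 + A2 ^+ 2)
    + (B1 ^+ 2 + B2 ^+ 2) * rdot c0 c0 + (C1 ^+ 2 + C2 ^+ 2) * rdot c1 c1
    + 2 * (B1 * rdot c0 v + B2 * idot c0 v)
    + 2 * ((B1 * A1 + B2 * A2) * rdot c0 x - (B1 * A2 - B2 * A1) * idot c0 x)
    + 2 * (C1 * rdot c1 v + C2 * idot c1 v)
    + 2 * ((C1 * A1 + C2 * A2) * rdot c1 x - (C1 * A2 - C2 * A1) * idot c1 x).
Proof.
move=> xx xv ixv c01 ic01.
have := rdot_ge0 (v + ((A1 +i* A2)%C *: x + ((B1 +i* B2)%C *: c0 + (C1 +i* C2)%C *: c1))).
rewrite !dotE.
rewrite !(rdotC x c0, rdotC x c1, rdotC v x, rdotC v c0, rdotC v c1, rdotC c1 c0).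
rewrite !(idotC x c0, idotC x c1, idotC v x, idotC v c0, idotC v c1, idotC c1 c0).
rewrite !idot_self xx xv ixv c01 ic01.
by congr (0 <= _); ring.
Qed.

End Hermitian.

Section Sphere.
Local Open Scope sesquilinear_scope.
Context {R : realType} {n : nat}.
Implicit Types (x v : 'M[R[i]]_(1 + (n - 1), 1)) (q : 'M[R[i]]_(1 + (n - 1))).
Implicit Types (B : 'M[R[i]]_(1, n - 1)).

Lemma stiefel1E x : stiefel R n 1 x <-> rdot x x = 1.
Proof.
rewrite /stiefel/= hermitian_mxE idot_self; split => [/matrixP/(_ 0 0)|->//].
by rewrite !mxE eqxx !mulr1n => -[].
Qed.

Lemma unitary_columns q : unitary_group R _ q ->
  (lsubmx q)^t* *m rsubmx q = 0 /\ (rsubmx q)^t* *m rsubmx q = 1%:M.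
Proof.
move=> /unitarymxP/mulmx1C.
rewrite -{2}[q]hsubmxK -{1}[q]hsubmxK tr_row_mx map_col_mx mul_col_row.
by rewrite scalar_mx_block => /eq_block_mx[].
Qed.

Lemma pi1_horizontal q B :
  pi1 n 1 (q *m horizontal_mx n 1 B) = - (rsubmx q *m B^t*).
Proof.
rewrite /pi1 -[q in LHS]hsubmxK mul_row_block row_mxKl mulmx0 add0r.
by rewrite mulmxN.
Qed.

Lemma hermitian0P x v : x^t* *m v = 0 <-> rdot x v = 0 /\ idot x v = 0.
Proof.
rewrite hermitian_mxE; split=> [/matrixP/(_ 0 0)|[-> ->]].
  by rewrite !mxE eqxx !mulr1n => -[].
by apply/matrixP => i j; rewrite !mxE mul0rn.
Qed.

Lemma horizontal_spaceE x v : stiefel R n 1 x ->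
  horizontal_space n 1 x v <-> rdot x v = 0 /\ idot x v = 0.
Proof.
move=> xS; rewrite -hermitian0P; split.
  move=> [q [B [qU <- ->]]]; have [lr _] := unitary_columns qU.
  by rewrite pi1_horizontal mulmxN mulmxA lr mul0mx oppr0.
(* Complete x to a unitary matrix q = (x, q2); then v = q2 q2^* v. *)
move=> xv; have := xS; rewrite -pi1_image => -[q qU qx].
exists q, (- (v^t* *m rsubmx q)); split=> //.
rewrite pi1_horizontal linearN/= map_mxN mulmxN opprK trmx_mul map_mxM trmxCK.
have : q *m q^t* = 1%:M by apply/unitarymxP.
rewrite -{2}[q]hsubmxK -{1}[q]hsubmxK tr_row_mx map_col_mx mul_row_col.
move=> /(congr1 (mulmx^~ v)); rewrite mul1mx mulmxDl -[X in X + _]mulmxA.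
by rewrite [lsubmx q]qx xv mulmx0 add0r mulmxA.
Qed.

Lemma sr_inner_rdot x v : horizontal_space n 1 x v ->
  sr_inner n 1 x v v = 4 * n%:R * rdot v v.
Proof.
move=> [q [B [qU <- ->]]]; have := sr_inner_pi1 B B qU.
set s := sr_inner _ _ _ _ _ => sE; set v' := pi1 n 1 (q *m _).
have [_ rr] := unitary_columns qU.
have BB : B *m B^t* = (rdot v' v')%:C%C%:M.
  have := hermitian_mxE v' v'; rewrite idot_self => <-.
  rewrite /v' pi1_horizontal mulmxN linearN/= map_mxN mulNmx opprK trmx_mul.
  by rewrite map_mxM trmxCK mulmxA -(mulmxA B) rr mulmx1.
have /complexI : s%:C%C = (4 * n%:R * rdot v' v')%:C%C.
  rewrite sE mulmx_block !mul0mx !mulmx0 !add0r !addr0 mxtrace_block.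
  rewrite mulmxN mulNmx [\tr (- (B^t* *m B))]linearN/= [\tr (B^t* *m B)]mxtrace_mulC.
  rewrite linearN/= BB mxtrace_scalar mulr1n !rmorphM/= !rmorph_nat.
  by ring.
by [].
Qed.

Lemma speedE (g : R -> 'M[R[i]]_(1 + (n - 1), 1)) t :
  horizontal_space n 1 (g t) (velocity g t) ->
  speed n 1 g t = Num.sqrt (4 * n%:R) * Num.sqrt (rdot (velocity g t) (velocity g t)).
Proof.
by move=> h; rewrite /speed sr_inner_rdot// [LHS]sqrtrM// mulr_ge0.
Qed.

End Sphere.

(** * Superpositions of two rotations *)

Section RealDerivatives.
Context {R : realType}.
Implicit Types (f g F : R -> R) (t df dg dF k : R).

Lemma is_derive_add f g t df dg : is_derive t (1 : R) f df ->
  is_derive t (1 : R) g dg -> is_derive t (1 : R) (fun s => f s + g s) (df + dg).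
Proof. exact: is_deriveD. Qed.

Lemma is_derive_sub f g t df dg : is_derive t (1 : R) f df ->
  is_derive t (1 : R) g dg -> is_derive t (1 : R) (fun s => f s - g s) (df - dg).
Proof. exact: is_deriveB. Qed.

Lemma is_derive_mul f g t df dg : is_derive t (1 : R) f df ->
  is_derive t (1 : R) g dg -> is_derive t (1 : R) (fun s => f s * g s) (f t * dg + g t * df).
Proof. exact: is_deriveM. Qed.

Lemma is_derive_scale k f t df : is_derive t (1 : R) f df ->
  is_derive t (1 : R) (fun s => k * f s) (k * df).
Proof. exact: is_deriveZ. Qed.

Lemma is_derive_lin k t : is_derive t (1 : R) (fun s => k * s) k.
Proof.
rewrite -[X in is_derive _ _ _ X]mulr1; exact: is_derive_scale.
Qed.

Lemma is_derive_compose F f t dF df : is_derive (f t) (1 : R) F dF ->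
  is_derive t (1 : R) f df -> is_derive t (1 : R) (fun s => F (f s)) (dF * df).
Proof. exact: is_derive1_comp. Qed.

Lemma is_derive_cast f t df dg : is_derive t (1 : R) f df -> df = dg ->
  is_derive t (1 : R) f dg.
Proof. by move=> ? <-. Qed.

End RealDerivatives.

Section CurveCoordinates.
Context {R : realType} {m : nat}.
Implicit Types (c : 'cV[R[i]]_m) (g : R -> 'cV[R[i]]_m).

Lemma ac_rdot T c g : ac_curve T g ->
  absolutely_continuous 0 T (fun t => rdot c (g t)).
Proof.
move=> acg; apply: ac_sum => j; have [acre acim] := acg j 0.
by apply: ac_add; exact: ac_scale.
Qed.

Lemma ac_idot T c g : ac_curve T g ->
  absolutely_continuous 0 T (fun t => idot c (g t)).
Proof.
move=> acg; apply: ac_sum => j; have [acre acim] := acg j 0.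
by apply: ac_add; [|apply: ac_opp]; exact: ac_scale.
Qed.

Lemma is_derive_sumE (F : 'I_m -> R -> R) (dF : 'I_m -> R) (t : R) :
  (forall j, is_derive t 1 (F j) (dF j)) ->
  is_derive t 1 (fun s => \sum_j F j s) (\sum_j dF j).
Proof.
move=> dFE; rewrite (_ : (fun s => _) = \sum_j F j).
  exact: is_derive_sum.
by apply/funext => s; rewrite fct_sumE.
Qed.

Lemma is_derive_coordinates g t j : curve_derivable g t ->
  is_derive t 1 (fun s => Re (g s j 0)) (Re (velocity g t j 0)) /\
  is_derive t 1 (fun s => Im (g s j 0)) (Im (velocity g t j 0)).
Proof.
move=> /(_ j 0)[dre dim]; rewrite !mxE /= !derive1E.
by split; exact: derivableP.
Qed.

Lemma is_derive_rdot c g t : curve_derivable g t ->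
  is_derive t 1 (fun s => rdot c (g s)) (rdot c (velocity g t)).
Proof.
move=> dg; apply: is_derive_sumE => j.
have [dre dim] := is_derive_coordinates j dg.
by apply: is_derive_add; exact: is_derive_scale.
Qed.

Lemma is_derive_idot c g t : curve_derivable g t ->
  is_derive t 1 (fun s => idot c (g s)) (idot c (velocity g t)).
Proof.
move=> dg; apply: is_derive_sumE => j.
have [dre dim] := is_derive_coordinates j dg.
by apply: is_derive_sub; exact: is_derive_scale.
Qed.

End CurveCoordinates.

Section TrigonometricSum.
Context {R : realType}.
Implicit Types (al be p q r u t T : R).

Definition trig_sum al be p q r u t : R :=
  p * cos (al * t) + q * sin (al * t) + (r * cos (be * t) + u * sin (be * t)).

Lemma is_derive_trig_sum al be p q r u t :
  is_derive t (1 : R) (trig_sum al be p q r u)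
    (al * (q * cos (al * t) - p * sin (al * t)) +
     be * (u * cos (be * t) - r * sin (be * t))).
Proof.
have dcos k : is_derive t (1 : R) (fun s => cos (k * s)) (- sin (k * t) * k).
  by apply: is_derive_compose; exact: is_derive_lin.
have dsin k : is_derive t (1 : R) (fun s => sin (k * s)) (cos (k * t) * k).
  by apply: is_derive_compose; exact: is_derive_lin.
have H := is_derive_add (is_derive_add (is_derive_scale p (dcos al)) (is_derive_scale q (dsin al)))
  (is_derive_add (is_derive_scale r (dcos be)) (is_derive_scale u (dsin be))).
by apply: (is_derive_cast H); ring.
Qed.

Lemma ac_trig_sum T al be p q r u : absolutely_continuous 0 T (trig_sum al be p q r u).
Proof.
have lip (F dF : R -> R) k : (forall x : R, is_derive x (1 : R) F (dF x)) ->
    (forall x, `|dF x| <= 1) -> absolutely_continuous 0 T (fun t => F (k * t)).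
  move=> dFE bnd; apply: (@ac_lipschitz _ _ _ `|k|) => // x y x0 xy yT.
  have -> : `|k| * (y - x) = 1 * `|k * y - k * x|.
    by rewrite -mulrBr normrM mul1r (ger0_norm (x := y - x)) ?subr_ge0.
  by apply: (@lipschitz_of_derivative _ (Num.min (k * x) (k * y)) (Num.max (k * x) (k * y)));
    rewrite // ?ge_min ?le_max lexx ?orbT.
have acc k : absolutely_continuous 0 T (fun t => cos (k * t)).
  by apply: (lip _ (fun x => - sin x)) => x; rewrite normrN sin_max.
have acs k : absolutely_continuous 0 T (fun t => sin (k * t)).
  by apply: (lip _ cos) => // x; exact: cos_max.
by apply: ac_add; apply: ac_add; apply: ac_scale.
Qed.

End TrigonometricSum.

Definition cis {R : realType} (t : R) : R[i] := (cos t +i* sin t)%C.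

(** The second vector turns backwards, so that the curves of interest have
    al, be >= 0. *)
Definition two_mode {R : realType} {m : nat} (al be : R) (c0 c1 : 'cV[R[i]]_m)
    (t : R) : 'cV[R[i]]_m :=
  cis (al * t) *: c0 + cis (- (be * t)) *: c1.

Section TwoMode.
Context {R : realType} {m : nat}.
Variables (al be : R) (c0 c1 : 'cV[R[i]]_m).
Implicit Types (t : R).

Let w := two_mode al be c0 c1.

Let ReE j : (fun t => Re (w t j 0)) =
  trig_sum al be (Re (c0 j 0)) (- Im (c0 j 0)) (Re (c1 j 0)) (Im (c1 j 0)).
Proof.
apply/funext => t; rewrite /w /two_mode /cis /trig_sum !mxE cosN sinN.
by case: (c0 j 0) (c1 j 0) => [? ?] [? ?] /=; ring.
Qed.

Let ImE j : (fun t => Im (w t j 0)) =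
  trig_sum al be (Im (c0 j 0)) (Re (c0 j 0)) (Im (c1 j 0)) (- Re (c1 j 0)).
Proof.
apply/funext => t; rewrite /w /two_mode /cis /trig_sum !mxE cosN sinN.
by case: (c0 j 0) (c1 j 0) => [? ?] [? ?] /=; ring.
Qed.

Lemma ac_two_mode T : ac_curve T w.
Proof. by move=> j k; rewrite ord1 ReE ImE; split; exact: ac_trig_sum. Qed.

Lemma derivable_two_mode t : curve_derivable w t.
Proof.
move=> j k; rewrite ord1 ReE ImE.
by split; apply: (@ex_derive _ _ _ _ _ _ _ (is_derive_trig_sum _ _ _ _ _ _ _)).
Qed.

Lemma velocity_two_mode t : velocity w t =
  (- (al * sin (al * t)) +i* (al * cos (al * t)))%C *: c0 +
  (- (be * sin (be * t)) +i* - (be * cos (be * t)))%C *: c1.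
Proof.
apply/matrixP => j k; rewrite (ord1 k) [LHS]mxE !derive1E ReE ImE.
rewrite !(@derive_val _ _ _ _ _ _ _ (is_derive_trig_sum _ _ _ _ _ _ _)) !mxE.
case: (c0 j 0) (c1 j 0) => [? ?] [? ?].
by apply/eqP; rewrite eq_complex /=; apply/andP; split; apply/eqP; ring.
Qed.

End TwoMode.

(** The conditions on c0 and c1 that make c0 exp(i a t) + c1 exp(- i (1 - a) t)
    a horizontal curve on the sphere. *)
Definition frame {R : realType} {m : nat} (a : R) (c0 c1 : 'cV[R[i]]_m) : Prop :=
  [/\ rdot c0 c0 = 1 - a, rdot c1 c1 = a, rdot c0 c1 = 0 & idot c0 c1 = 0].

Section TwoModeGeometry.
Context {R : realType} {m : nat}.
Variables (a : R) (c0 c1 : 'cV[R[i]]_m).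
Hypothesis fr : frame a c0 c1.
Implicit Types (al be t : R).

Let twoE al be t : two_mode al be c0 c1 t =
  (cos (al * t) +i* sin (al * t))%C *: c0 + (cos (be * t) +i* - sin (be * t))%C *: c1.
Proof. by rewrite /two_mode /cis cosN sinN. Qed.

Let rdot10 : rdot c1 c0 = 0.
Proof. by case: fr => _ _ c01 _; rewrite rdotC. Qed.

Let idot10 : idot c1 c0 = 0.
Proof. by case: fr => _ _ _ c01; rewrite idotC c01 oppr0. Qed.

Lemma two_mode_sphere al be t : rdot (two_mode al be c0 c1 t) (two_mode al be c0 c1 t) = 1.
Proof.
have [c00 c11 c01 ic01] := fr.
rewrite twoE !dotE !idot_self c00 c11 c01 ic01 rdot10 idot10.
transitivity ((1 - a) * (cos (al * t) ^+ 2 + sin (al * t) ^+ 2) +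
  a * (cos (be * t) ^+ 2 + sin (be * t) ^+ 2)); first by ring.
by rewrite !cos2Dsin2; ring.
Qed.

(** The hermitian product of the curve and its velocity is the constant
    i (al |c0|^2 - be |c1|^2), since the cross terms vanish. *)
Lemma two_mode_horizontal al be t : al * (1 - a) = be * a ->
  let w := two_mode al be c0 c1 in
  rdot (w t) (velocity w t) = 0 /\ idot (w t) (velocity w t) = 0.
Proof.
move=> ab w; have [c00 c11 c01 ic01] := fr.
rewrite /w velocity_two_mode twoE !dotE !idot_self c00 c11 c01 ic01 rdot10 idot10.
split; first by ring.
transitivity ((al * (1 - a)) * (cos (al * t) ^+ 2 + sin (al * t) ^+ 2) -
  (be * a) * (cos (be * t) ^+ 2 + sin (be * t) ^+ 2)); first by ring.
by rewrite !cos2Dsin2 ab; ring.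
Qed.

Lemma two_mode_energy al be t : let w := two_mode al be c0 c1 in
  rdot (velocity w t) (velocity w t) = al ^+ 2 * (1 - a) + be ^+ 2 * a.
Proof.
have [c00 c11 c01 ic01] := fr.
rewrite /= velocity_two_mode !dotE !idot_self c00 c11 c01 ic01 rdot10 idot10.
transitivity (al ^+ 2 * (1 - a) * (cos (al * t) ^+ 2 + sin (al * t) ^+ 2) +
  be ^+ 2 * a * (cos (be * t) ^+ 2 + sin (be * t) ^+ 2)); first by ring.
by rewrite !cos2Dsin2 !mulr1.
Qed.

End TwoModeGeometry.

(** The two angular velocities are proportional to a and 1 - a, which is what
    two_mode_horizontal requires for a frame; k is the time scale. *)
Definition geodesic_arc {R : realType} {m : nat} (a k : R) (c0 c1 : 'cV[R[i]]_m) :=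
  two_mode (k * a) (k * (1 - a)) c0 c1.

Section Arc.
Context {R : realType} {n : nat}.
Variables (a k : R) (c0 c1 : 'M[R[i]]_(1 + (n - 1), 1)).
Hypotheses (fr : frame a c0 c1) (k0 : 0 <= k).

Let g : R -> 'M[R[i]]_(1 + (n - 1), 1) := geodesic_arc a k c0 c1.

Lemma arc_stiefel t : stiefel R n 1 (g t).
Proof. by apply/stiefel1E; exact: (two_mode_sphere fr). Qed.

Lemma arc_horizontal_space t : horizontal_space n 1 (g t) (velocity g t).
Proof.
apply/horizontal_spaceE; first exact: arc_stiefel.
by apply: (two_mode_horizontal fr); ring.
Qed.

Lemma arc_horizontal T : horizontal_curve n 1 T g.
Proof.
split.
- by move=> t _; exact: arc_stiefel.
- exact: ac_two_mode.
- apply: aeW => t _; split; first exact: derivable_two_mode.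
  exact: arc_horizontal_space.
Qed.

Lemma arc_speed t : speed n 1 g t = Num.sqrt (4 * n%:R) * (k * Num.sqrt (a * (1 - a))).
Proof.
rewrite speedE; last exact: arc_horizontal_space.
rewrite (two_mode_energy fr).
have -> : (k * a) ^+ 2 * (1 - a) + (k * (1 - a)) ^+ 2 * a = k ^+ 2 * (a * (1 - a)).
  by ring.
by rewrite [Num.sqrt (k ^+ 2 * _)]sqrtrM ?sqr_ge0// sqrtr_sqr ger0_norm.
Qed.

Lemma arc_length T : 0 <= T -> curve_length n 1 T g =
  (Num.sqrt (4 * n%:R) * (k * Num.sqrt (a * (1 - a))) * T)%:E.
Proof.
move=> T0; rewrite /curve_length.
under eq_integral do rewrite arc_speed.
rewrite integral_cst//= lebesgue_measure_itv/= lte_fin.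
move: T0; rewrite le_eqVlt => /predU1P[<-|->].
  by rewrite ltxx mule0 mulr0.
by rewrite -EFinB -EFinM subr0.
Qed.

End Arc.

(** * The calibration *)

(** The differential inequality behind everything, in one fixed position x with
    velocity v; sg is the derivative of the reparametrization tau, (ca, sa) and
    (cb, sb) are the cosines and sines of a tau and (1 - a) tau.  With
    P = exp(- i a tau) <c0, x> and Q = exp(i (1 - a) tau) <c1, x>, one has
    2 U'.r = Im (P - Q) and |r|^2 = 2 - 2 Re (P + Q), so the left-hand side is
    sg h' with the Riccati equation substituted for rho'.  The difference of
    the two sides is |r' - sg rho r|^2, with the derivative in time, where
    r' - sg rho r is written as a combination of v, x, c0 and c1. *)
Lemma calibration_rate {R : realType} {m : nat} (x v c0 c1 : 'cV[R[i]]_m)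
    (a K rho sg ca sa cb sb : R) :
  ca ^+ 2 + sa ^+ 2 = 1 -> cb ^+ 2 + sb ^+ 2 = 1 ->
  rdot x x = 1 -> rdot x v = 0 -> idot x v = 0 ->
  rdot c0 c0 = 1 - a -> rdot c1 c1 = a -> rdot c0 c1 = 0 -> idot c0 c1 = 0 ->
  let b := 1 - a in
  let ReP := ca * rdot c0 x + sa * idot c0 x in
  let ImP := ca * idot c0 x - sa * rdot c0 x in
  let ReQ := cb * rdot c1 x - sb * idot c1 x in
  let ImQ := cb * idot c1 x + sb * rdot c1 x in
  let dReP := ca * rdot c0 v + sa * idot c0 v + a * sg * ImP in
  let dImP := ca * idot c0 v - sa * rdot c0 v - a * sg * ReP in
  let dReQ := cb * rdot c1 v - sb * idot c1 v - b * sg * ImQ in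
  let dImQ := cb * idot c1 v + sb * rdot c1 v + b * sg * ReQ in
  let D := 2 - 2 * (ReP + ReQ) in
  is_true (sg * (dImP - dImQ - 2 * rho * (dReP + dReQ) - (K ^+ 2 + rho ^+ 2) * sg * D)
    <= rdot v v - sg ^+ 2 * (a * b) - sg ^+ 2 * (K ^+ 2 - 4^-1) * D).
Proof.
move=> cs cs' xx xv ixv c00 c11 c01 ic01 b ReP ImP ReQ ImQ dReP dImP dReQ dImQ D.
(* In the rotating frame, r' - sg rho r is v + A x + B c0 + C c1 with
   A = sg (i (1/2 - a) - rho), B = sg (rho - i/2) (ca + i sa) and
   C = sg (rho + i/2) (cb - i sb). *)
have := gram_ge0 (- (sg * rho)) (sg * (2^-1 - a))
  (sg * (rho * ca + 2^-1 * sa)) (sg * (rho * sa - 2^-1 * ca))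
  (sg * (rho * cb + 2^-1 * sb)) (sg * (2^-1 * cb - rho * sb)) xx xv ixv c01 ic01.
have -> : (sg * (rho * ca + 2^-1 * sa)) ^+ 2 + (sg * (rho * sa - 2^-1 * ca)) ^+ 2
   = sg ^+ 2 * (rho ^+ 2 + 4^-1).
  transitivity (sg ^+ 2 * (rho ^+ 2 + 4^-1) * (ca ^+ 2 + sa ^+ 2)); first by field.
  by rewrite cs mulr1.
have -> : (sg * (rho * cb + 2^-1 * sb)) ^+ 2 + (sg * (2^-1 * cb - rho * sb)) ^+ 2
   = sg ^+ 2 * (rho ^+ 2 + 4^-1).
  transitivity (sg ^+ 2 * (rho ^+ 2 + 4^-1) * (cb ^+ 2 + sb ^+ 2)); first by field.
  by rewrite cs' mulr1.
rewrite c00 c11 -subr_ge0 => H; rewrite -subr_ge0; apply: (le_trans H).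
rewrite le_eqVlt; apply/orP; left; apply/eqP.
rewrite /D /dReP /dImP /dReQ /dImQ /ReP /ImP /ReQ /ImQ /b.
by field.
Qed.

(** The squared distance from x to the arc at time th (see gapE), expanded so
    that it is affine in x. *)
Definition gap {R : realType} {m : nat} (a : R) (c0 c1 x : 'cV[R[i]]_m) (th : R) : R :=
  2 - 2 * ((cos (a * th) * rdot c0 x + sin (a * th) * idot c0 x) +
           (cos ((1 - a) * th) * rdot c1 x - sin ((1 - a) * th) * idot c1 x)).

(** The function h = 2 U'.r + rho |r|^2 of the comparison argument. *)
Definition calibration {R : realType} {m : nat} (a K r : R) (c0 c1 x : 'cV[R[i]]_m)
    (th : R) : R :=
  (cos (a * th) * idot c0 x - sin (a * th) * rdot c0 x) -
  (cos ((1 - a) * th) * idot c1 x + sin ((1 - a) * th) * rdot c1 x) +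
  - K * tan (K * (th - r)) * gap a c0 c1 x th.

Section Gap.
Context {R : realType} {m : nat}.
Variables (a : R) (c0 c1 : 'cV[R[i]]_m).
Hypothesis fr : frame a c0 c1.
Implicit Types (x : 'cV[R[i]]_m) (th : R).

Let G th := two_mode a (1 - a) c0 c1 th.

Let rdotG x th : rdot (G th) x =
  (cos (a * th) * rdot c0 x + sin (a * th) * idot c0 x) +
  (cos ((1 - a) * th) * rdot c1 x - sin ((1 - a) * th) * idot c1 x).
Proof. by rewrite /G /two_mode /cis cosN sinN !dotE; ring. Qed.

Lemma gapE x th : rdot x x = 1 -> gap a c0 c1 x th = rdot (x - G th) (x - G th).
Proof.
move=> xx; have GG : rdot (G th) (G th) = 1 := two_mode_sphere fr _ _ _.
have := rdotG x th; rewrite /gap => <-; move: (G th) GG => y yy.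
by rewrite !dotE (rdotC x y) xx yy; ring.
Qed.

Lemma gap_ge0 x th : rdot x x = 1 -> 0 <= gap a c0 c1 x th.
Proof. by move=> /gapE ->; exact: rdot_ge0. Qed.

Lemma gap_le4 x th : rdot x x = 1 -> gap a c0 c1 x th <= 4.
Proof.
move=> xx; rewrite -subr_ge0; apply: le_trans (rdot_ge0 (x + G th)) _.
have GG : rdot (G th) (G th) = 1 := two_mode_sphere fr _ _ _.
have := rdotG x th; rewrite /gap => <-; move: (G th) GG => y yy.
by rewrite !dotE (rdotC x y) xx yy le_eqVlt; apply/orP; left; apply/eqP; ring.
Qed.

(** On the arc the gap vanishes, while P = 1 - a and Q = a are real. *)
Lemma calibration_arc K r th : calibration a K r c0 c1 (G th) th = 0.
Proof.
rewrite /calibration gapE; last exact: (two_mode_sphere fr).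
have -> : G th - G th = 0 by rewrite subrr.
have -> : rdot (0 : 'cV[R[i]]_m) 0 = 0.
  by apply: big1 => j _; rewrite mxE /=; ring.
have [c00 c11 c01 ic01] := fr.
rewrite mulr0 addr0 /G /two_mode /cis cosN sinN !dotE !idot_self c00 c11 c01 ic01.
by rewrite (rdotC c1 c0) (idotC c1 c0) c01 ic01; ring.
Qed.

Lemma calibration_derive K r (g : R -> 'cV[R[i]]_m) (tau : R -> R) (t sg : R) :
  curve_derivable g t -> is_derive t (1 : R) tau sg ->
  cos (K * (tau t - r)) != 0 ->
  rdot (g t) (g t) = 1 -> rdot (g t) (velocity g t) = 0 -> idot (g t) (velocity g t) = 0 ->
  exists dh, is_derive t (1 : R) (fun s => calibration a K r c0 c1 (g s) (tau s)) dh /\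
    sg * dh <= rdot (velocity g t) (velocity g t) - sg ^+ 2 * (a * (1 - a))
      - sg ^+ 2 * (K ^+ 2 - 4^-1) * gap a c0 c1 (g t) (tau t).
Proof.
move=> dg dtau cos0 xx xv ixv; have [c00 c11 c01 ic01] := fr.
have dshift : is_derive t (1 : R) (fun s => tau s - r) sg.
  have H := is_derive_sub dtau (is_derive_cst r t 1).
  by apply: (is_derive_cast H); rewrite subr0.
have drho : is_derive t (1 : R) (fun s => tan (K * (tau s - r)))
    ((cos (K * (tau t - r))) ^- 2 * (K * sg)).
  exact: (@is_derive_compose _ tan (fun s => K * (tau s - r)) _ _ _
    (is_derive_tan cos0) (is_derive_scale K dshift)).
have dcos k : is_derive t (1 : R) (fun s => cos (k * tau s)) (- sin (k * tau t) * (k * sg)).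
  exact: (@is_derive_compose _ cos (fun s => k * tau s) _ _ _
    (is_derive_cos (k * tau t)) (is_derive_scale k dtau)).
have dsin k : is_derive t (1 : R) (fun s => sin (k * tau s)) (cos (k * tau t) * (k * sg)).
  exact: (@is_derive_compose _ sin (fun s => k * tau s) _ _ _
    (is_derive_sin (k * tau t)) (is_derive_scale k dtau)).
have dr0 := is_derive_rdot c0 dg; have di0 := is_derive_idot c0 dg.
have dr1 := is_derive_rdot c1 dg; have di1 := is_derive_idot c1 dg.
have dReP := is_derive_add (is_derive_mul (dcos a) dr0) (is_derive_mul (dsin a) di0).
have dImP := is_derive_sub (is_derive_mul (dcos a) di0) (is_derive_mul (dsin a) dr0).
have dReQ := is_derive_sub (is_derive_mul (dcos (1 - a)) dr1) (is_derive_mul (dsin (1 - a)) di1).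
have dImQ := is_derive_add (is_derive_mul (dcos (1 - a)) di1) (is_derive_mul (dsin (1 - a)) dr1).
have dgap := is_derive_sub (is_derive_cst (2 : R) t 1)
  (is_derive_scale 2 (is_derive_add dReP dReQ)).
have drho' := is_derive_scale (- K) drho.
have dcal := is_derive_add (is_derive_sub dImP dImQ) (is_derive_mul drho' dgap).
have rate := calibration_rate K (- K * tan (K * (tau t - r))) sg
  (cos2Dsin2 (a * tau t)) (cos2Dsin2 ((1 - a) * tau t)) xx xv ixv c00 c11 c01 ic01.
eexists; split; first exact: dcal.
apply: le_trans rate; rewrite cos2_tan2// le_eqVlt; apply/orP; left; apply/eqP.
by rewrite /gap /=; ring.
Qed.

End Gap.

Section CalibrationAC.
Context {R : realType} {m : nat}.
Variables (a T lo hi : R) (c0 c1 : 'cV[R[i]]_m) (g : R -> 'cV[R[i]]_m) (tau : R -> R).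
Hypotheses (T0 : 0 <= T) (acg : ac_curve T g) (actau : absolutely_continuous 0 T tau).
Hypothesis range : forall t, 0 <= t -> t <= T -> lo <= tau t <= hi.

Let accos k : absolutely_continuous 0 T (fun t => cos (k * tau t)).
Proof.
apply: (@ac_comp _ _ _ lo hi `|k| (fun th => cos (k * th))) => // u v uI vI.
apply: (@lipschitz_of_derivative _ lo hi `|k| (fun th => cos (k * th))
  (fun th => - sin (k * th) * k)) => // th _.
  exact: (@is_derive_compose _ cos (fun s => k * s) _ _ _ (is_derive_cos _) (is_derive_lin k th)).
by rewrite normrM normrN ler_piMl// sin_max.
Qed.

Let acsin k : absolutely_continuous 0 T (fun t => sin (k * tau t)).
Proof.
apply: (@ac_comp _ _ _ lo hi `|k| (fun th => sin (k * th))) => // u v uI vI.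
apply: (@lipschitz_of_derivative _ lo hi `|k| (fun th => sin (k * th))
  (fun th => cos (k * th) * k)) => // th _.
  exact: (@is_derive_compose _ sin (fun s => k * s) _ _ _ (is_derive_sin _) (is_derive_lin k th)).
by rewrite normrM ler_piMl// cos_max.
Qed.

Lemma ac_gap : absolutely_continuous 0 T (fun t => gap a c0 c1 (g t) (tau t)).
Proof.
have r0 := ac_rdot c0 acg; have i0 := ac_idot c0 acg.
have r1 := ac_rdot c1 acg; have i1 := ac_idot c1 acg.
apply: ac_sub; first exact: ac_cst.
apply: ac_scale; apply: ac_add; first by apply: ac_add; exact: ac_mul.
by apply: ac_sub; exact: ac_mul.
Qed.

Lemma ac_calibration K r d :
  0 < d -> (forall th, lo <= th <= hi -> d <= cos (K * (th - r))) ->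
  absolutely_continuous 0 T (fun t => calibration a K r c0 c1 (g t) (tau t)).
Proof.
move=> d0 cosd.
have actan : absolutely_continuous 0 T (fun t => tan (K * (tau t - r))).
  apply: (@ac_comp _ _ _ lo hi (d ^- 2 * `|K|) (fun th => tan (K * (th - r)))) => // [|u v uI vI].
    by rewrite mulr_ge0// invr_ge0 sqr_ge0.
  apply: (@lipschitz_of_derivative _ lo hi (d ^- 2 * `|K|) (fun th => tan (K * (th - r)))
    (fun th => (cos (K * (th - r))) ^- 2 * (K * (1 - 0))))
    => // th /cosd cd; have c0' := lt_le_trans d0 cd.
    have cn0 : cos (K * (th - r)) != 0 by rewrite gt_eqF.
    have dshift := is_derive_sub (is_derive_id th 1) (is_derive_cst r th 1).
    exact: (@is_derive_compose _ tan (fun x => K * (x - r)) _ _ _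
      (is_derive_tan cn0) (is_derive_scale K dshift)).
  rewrite subr0 mulr1 normrM ger0_norm ?invr_ge0 ?sqr_ge0// ler_wpM2r//.
  by rewrite lef_pV2 ?posrE ?exprn_gt0// ler_pXn2r ?nnegrE// ltW.
have r0 := ac_rdot c0 acg; have i0 := ac_idot c0 acg.
have r1 := ac_rdot c1 acg; have i1 := ac_idot c1 acg.
apply: ac_add.
  apply: ac_sub; first by apply: ac_sub; exact: ac_mul.
  by apply: ac_add; exact: ac_mul.
by apply: ac_mul => //; [exact: ac_scale|exact: ac_gap].
Qed.

End CalibrationAC.

(** * Comparison with an arc *)

(** Keeps the tangent in the calibration away from its poles. *)
Lemma cos_ge_window {R : realType} (K r : R) : 0 < K -> 0 <= r -> K * r < pi / 2 ->
  0 < cos (K * r) /\ forall th, 0 <= th <= 2 * r -> cos (K * r) <= cos (K * (th - r)).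
Proof.
move=> K0 r0 Kr; have pi0 := @pi_gt0 R; have Kr0 : 0 <= K * r by rewrite mulr_ge0// ltW.
split; first by apply: cos_gt0_pihalf; apply/andP; split; lra.
move=> th /andP[th0 thr]; rewrite -(cos_norm (K * (th - r))) normrM gtr0_norm//.
have nr : `|th - r| <= r by rewrite ler_norml; apply/andP; split; lra.
have Kn : K * `|th - r| <= K * r by rewrite ler_pM2l.
have n0 : 0 <= K * `|th - r| by rewrite mulr_ge0// ltW.
rewrite leNgt ltr_cos ?in_itv/=; first by rewrite -leNgt.
  by rewrite Kr0/=; lra.
by rewrite n0/=; lra.
Qed.

Section Comparison.
Context {R : realType} {n : nat}.
Variables (a T : R) (c0 c1 : 'M[R[i]]_(1 + (n - 1), 1)) (g : R -> 'M[R[i]]_(1 + (n - 1), 1)).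
Hypotheses (fr : frame a c0 c1) (T0 : 0 < T).
Hypothesis hg : horizontal_curve n 1 T g.

Let G (th : R) : 'M[R[i]]_(1 + (n - 1), 1) := two_mode a (1 - a) c0 c1 th.

Lemma horizontal_curve_ae : {ae lebesgue_measure, forall t : R, 0 < t < T ->
  [/\ curve_derivable g t, horizontal_space n 1 (g t) (velocity g t), rdot (g t) (g t) = 1 &
   rdot (g t) (velocity g t) = 0 /\ idot (g t) (velocity g t) = 0]}.
Proof.
have [sg _] := hg; apply: ae_imp => t H /andP[/ltW t0 /ltW tT].
have tI : 0 <= t <= T by rewrite t0.
have [dg hs] := H tI; have st := sg t tI.
by split=> //; [exact/stiefel1E|exact/horizontal_spaceE].
Qed.

Lemma calibrated_ae K r tau sg d :
  absolutely_continuous 0 T tau -> (forall t, 0 <= t -> t <= T -> 0 <= tau t <= 2 * r) ->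
  0 < d -> (forall th, 0 <= th <= 2 * r -> d <= cos (K * (th - r))) ->
  {ae lebesgue_measure, forall t : R, 0 < t < T -> is_derive t (1 : R) tau (sg t)} ->
  let h := fun t => calibration a K r c0 c1 (g t) (tau t) in
  absolutely_continuous 0 T h /\
  {ae lebesgue_measure, forall t : R, 0 < t < T -> exists dh, is_derive t (1 : R) h dh /\
    sg t * dh <= rdot (velocity g t) (velocity g t) - sg t ^+ 2 * (a * (1 - a))
      - sg t ^+ 2 * (K ^+ 2 - 4^-1) * gap a c0 c1 (g t) (tau t)}.
Proof.
move=> actau range d0 cosd dtau h; split.
  have [_ acg _] := hg.
  apply: (@ac_calibration _ _ _ _ 0 (2 * r) _ _ _ _ _ acg actau range _ _ d) => //; exact: ltW.
apply: ae_imp (ae_and dtau horizontal_curve_ae) => t [dt H] tT.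
have [dg _ xx [xv ixv]] := H tT; have dtt := dt tT.
apply: calibration_derive => //; rewrite gt_eqF//; apply: lt_le_trans d0 _.
by case/andP: tT => *; apply: cosd; apply: range; exact: ltW.
Qed.

(** Before time 2 pi, that is before the first conjugate time, one can take
    K > 1/2.  Then h is nonincreasing and vanishes at both ends, so it vanishes
    identically; hence its derivative does, and the term (K^2 - 1/4) D forces
    the gap D to be zero. *)
Lemma arc_unique t0 : 0 < t0 < 2 * pi -> g 0 = G 0 -> g T = G t0 ->
  {ae lebesgue_measure, forall t : R, 0 < t < T ->
    rdot (velocity g t) (velocity g t) <= (t0 / T) ^+ 2 * (a * (1 - a))} ->
  forall t, 0 <= t <= T -> g t = G (t0 / T * t).
Proof.
move=> /andP[t00 t02] g0 gT slow.
have [sg0 acg _] := hg.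
have k0 : 0 < t0 / T by rewrite divr_gt0.
set k := t0 / T in slow k0 *.
have kT : k * T = t0 by rewrite /k divfK// gt_eqF.
(* t0 < 2 pi leaves room between 1/2 and pi / t0. *)
have [K [K2 Kr]] : exists K, 2^-1 < K /\ K * (t0 / 2) < pi / 2.
  have q : 2^-1 < pi / t0.
    by rewrite ltr_pdivlMr// mulrC ltr_pdivrMr// mulrC.
  exists ((2^-1 + pi / t0) / 2); split; first by lra.
  have -> : pi / 2 = pi / t0 * (t0 / 2) by field; rewrite gt_eqF.
  by rewrite ltr_pM2r; lra.
have K0 : 0 < K by lra.
have [d0 cosd] := cos_ge_window K0 (ltW (divr_gt0 t00 (ltr0Sn _ 1))) Kr.
pose tau t := k * t.
have actau : absolutely_continuous 0 T tau.
  apply: (@ac_lipschitz _ _ _ k); first exact: ltW.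
  by move=> u v _ uv _; rewrite -mulrBr normrM gtr0_norm// ger0_norm// subr_ge0.
have tau_range t : 0 <= t -> t <= T -> 0 <= tau t <= 2 * (t0 / 2).
  move=> tt tT; have -> : 2 * (t0 / 2) = t0 by field.
  by rewrite mulr_ge0 ?(ltW k0)//= -kT ler_pM2l.
have dtau : {ae lebesgue_measure, forall t : R, 0 < t < T -> is_derive t (1 : R) tau k}.
  by apply: aeW => t _; exact: is_derive_lin.
have [ach rateh] := calibrated_ae actau tau_range d0 cosd dtau.
set h := fun t => calibration a K (t0 / 2) c0 c1 (g t) (tau t) in ach rateh.
have K4 : 0 < K ^+ 2 - 4^-1.
  have -> : K ^+ 2 - 4^-1 = (K - 2^-1) * (K + 2^-1) by field.
  by rewrite mulr_gt0; lra.
have h0 : h 0 = 0 by rewrite /h /tau mulr0 g0; exact: calibration_arc.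
have hT : h T = 0 by rewrite /h /tau kT gT; exact: calibration_arc.
have rate : {ae lebesgue_measure, forall t : R, 0 < t < T -> exists dh, [/\
    is_derive t (1 : R) h dh,
    dh <= 0 & dh = 0 -> gap a c0 c1 (g t) (tau t) = 0]}.
  apply: ae_imp (ae_and (ae_and rateh slow) horizontal_curve_ae) => t [[Hh Hs] Ht] tT.
  have [dh [ddh le]] := Hh tT; have sl := Hs tT; have [_ _ xx _] := Ht tT.
  have gp := gap_ge0 fr (tau t) xx.
  have pos : 0 <= k ^+ 2 * (K ^+ 2 - 4^-1) * gap a c0 c1 (g t) (tau t).
    by rewrite mulr_ge0// mulr_ge0 ?sqr_ge0// ltW.
  exists dh; split=> //.
    by rewrite -(pmulr_rle0 _ k0); lra.
  move=> dh0; apply/eqP; rewrite eq_le gp andbT.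
  have kk : 0 < k ^+ 2 * (K ^+ 2 - 4^-1) by rewrite mulr_gt0// exprn_gt0.
  by rewrite -(pmulr_rle0 _ kk); move: le; rewrite dh0 mulr0; lra.
have mono s1 s2 : 0 <= s1 -> s1 <= s2 -> s2 <= T -> h s2 <= h s1.
  move=> s10 s12 s2T; rewrite -lerN2.
  apply: (@ac_nondecreasing _ s1 s2 (fun t => - h t)) => //.
    by apply: ac_opp; exact: (@ac_subitv _ 0 T).
  apply: ae_imp rate => t Ht /andP[st ts].
  have [|dh' [ddh le0 _]] := Ht; first by apply/andP; split; lra.
  have H : is_derive t (1 : R) (fun s => - h s) (- dh') by exact: is_deriveN.
  by rewrite derive1E (@derive_val _ _ _ _ _ _ _ H) oppr_ge0; split=> //; case: H.
have hz t : 0 <= t <= T -> h t = 0.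
  move=> /andP[t0' tT].
  have A := mono 0 t (lexx 0) t0' tT; have B := mono t T t0' tT (lexx T).
  by apply/eqP; rewrite eq_le -[X in h t <= X]h0 A/= -hT.
have gap0 t : 0 <= t <= T -> gap a c0 c1 (g t) (tau t) = 0.
  have acgap : absolutely_continuous 0 T (fun t => gap a c0 c1 (g t) (tau t)).
    apply: (@ac_gap _ _ a T 0 (2 * (t0 / 2)) c0 c1 g tau) => //; exact: ltW.
  suff aez : {ae lebesgue_measure, forall s : R, 0 < s < T ->
      gap a c0 c1 (g s) (tau s) = 0} by exact: (ac_ae_zero T0 acgap aez).
  apply: ae_imp rate => s Hs sT.
  have [dh' [ddh _ zero]] := Hs sT; apply: zero.
  have dh0 : is_derive s (1 : R) h 0.
    apply: (near_eq_is_derive _ (is_derive_cst (0 : R) s 1)) => //.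
    have sI : s \in `]0, T[ by rewrite in_itv.
    near=> x; rewrite hz//; apply/andP; split; apply: ltW; near: x.
    - by apply: lt_nbhsr; case/andP: sT.
    - by apply: lt_nbhsl; case/andP: sT.
  by rewrite -(@derive_val _ _ _ _ _ _ _ ddh) (@derive_val _ _ _ _ _ _ _ dh0).
move=> t tT; have xx : rdot (g t) (g t) = 1 by apply/stiefel1E; exact: sg0.
have := gap0 t tT; rewrite (gapE fr)// => /rdot_eq0/eqP; rewrite subr_eq0 => /eqP.
by [].
Unshelve. all: by end_near. Qed.

End Comparison.

(** S is the euclidean arclength.  Its derivative w is the speed cut off outside
    a measurable set of full measure where the velocity exists, which makes it
    measurable; this only decreases the integral. *)
Lemma horizontal_arclength {R : realType} {n : nat} (T : R)
    (g : R -> 'M[R[i]]_(1 + (n - 1), 1)) : 0 < T -> (0 < n)%N ->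
  horizontal_curve n 1 T g -> (curve_length n 1 T g < +oo)%E ->
  exists S w : R -> R, [/\ absolutely_continuous 0 T S, S 0 = 0,
    ((Num.sqrt (4 * n%:R) * S T)%:E <= curve_length n 1 T g)%E,
    forall u v, u <= v -> S u <= S v &
    {ae lebesgue_measure, forall t : R, 0 < t < T -> [/\ is_derive t (1 : R) S (w t),
      0 <= w t & w t ^+ 2 = rdot (velocity g t) (velocity g t)]}].
Proof.
move=> T0 n0 hg fin; have [_ acg _] := hg.
have [N [mN N0 badN]] := horizontal_curve_ae hg.
pose Gd : set R := `]0, T[%classic `\` N.
have mGd : measurable Gd by apply: measurableD => //; exact: measurable_itv.
have GdP t : Gd t -> 0 < t < T /\ [/\ curve_derivable g t,
    horizontal_space n 1 (g t) (velocity g t) & rdot (g t) (g t) = 1].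
  move=> [/=]; rewrite in_itv/= => tT Nt; split=> //; apply: contrapT => H; apply: Nt.
  by apply: badN => /= /(_ tT)[? ? ? _]; apply: H.
pose v t := Num.sqrt (rdot (velocity g t) (velocity g t)).
pose w := v \_ Gd.
have w_ge0 t : 0 <= w t by rewrite /w patchE; case: ifP => // _; exact: sqrtr_ge0.
have mentry (f : R -> R) : absolutely_continuous 0 T f ->
    (forall t, Gd t -> derivable f t 1) -> measurable_fun Gd (derive1 f).
  move=> acf df; apply: (measurable_derivative (ltW T0) acf) => // t Gt.
  by have [tT _] := GdP t Gt; split=> //; exact: df.
have mv : measurable_fun Gd v.
  apply: (@measurable_comp _ _ _ _ _ _ setT) => //.
    by apply: continuous_measurable_fun; exact: sqrt_continuous.
  rewrite /rdot; apply: measurable_sum => j.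
  under eq_fun do rewrite mxE /=.
  have [acre acim] := acg j 0.
  apply: measurable_funD; apply: measurable_funM; apply: mentry => // t Gt;
    by have [_ [/(_ j 0)[dre dim] _ _]] := GdP t Gt.
have mw : measurable_fun setT w by apply/(measurable_restrictT _ _).1.
pose C := Num.sqrt (4 * n%:R) : R.
have C0 : 0 < C by rewrite sqrtr_gt0 mulr_gt0// ltr0n.
have le_speed : (\int[lebesgue_measure]_(t in `[0%R, T]) (C * w t)%:E <= curve_length n 1 T g)%E.
  apply: (ge0_le_integral_negligible (N := set0)) => //.
  - by move=> t _; rewrite lee_fin mulr_ge0// ltW.
  - by move=> t _; rewrite lee_fin sqrtr_ge0.
  - move=> t _ _; rewrite lee_fin /w patchE; case: ifPn => [/set_mem Gt|_].
      by have [_ [_ hs _]] := GdP t Gt; rewrite speedE.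
    by rewrite mulr0 sqrtr_ge0.
have intC : (\int[lebesgue_measure]_(t in `[0%R, T]) (C * w t)%:E =
    C%:E * \int[lebesgue_measure]_(t in `[0%R, T]) (w t)%:E)%E.
  under eq_integral do rewrite EFinM.
  rewrite ge0_integralZl//.
  - by apply/measurable_EFinP; exact: measurable_funTS.
  - by move=> t _; rewrite lee_fin.
  - by rewrite lee_fin ltW.
have wout t : ~ (0 < t < T) -> w t = 0.
  by move=> tT; rewrite /w patchE; case: ifPn => // /set_mem /GdP[].
have iw : lebesgue_measure.-integrable setT (EFin \o w).
  apply/integrableP; split; first exact/measurable_EFinP.
  have -> : (\int[lebesgue_measure]_x `|(EFin \o w) x| =
      \int[lebesgue_measure]_(t in `[0%R, T]) (w t)%:E)%E.
    rewrite [RHS]integral_mkcond; apply: eq_integral => t _ /=.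
    rewrite patchE ger0_norm//; case: ifPn => // /negP tT; congr (_%:E).
    apply: wout => /andP[t0 tT']; apply: tT; apply/mem_set => /=.
    by rewrite in_itv/= !ltW.
  have := le_lt_trans le_speed fin; rewrite intC ltey_eq.
  have : (0 <= \int[lebesgue_measure]_(t in `[0%R, T]) (w t)%:E)%E.
    by apply: integral_ge0 => t _; rewrite lee_fin.
  case: (\int[_]_(t in _) _)%E => [r||]//=; first by rewrite ltry.
  by rewrite gt0_muley ?lte_fin// => _; rewrite orbF.
have [S [acS S0 ST Smono dS]] := indefinite_integral_ac (ltW T0) w_ge0 wout iw.
exists S, w; split=> //.
  by rewrite EFinM ST -intC.
have aeG : {ae lebesgue_measure, forall t : R, 0 < t < T -> Gd t}.
  exists N; split=> // t /= /not_implyP[tT]; apply: contra_notP => Nt.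
  by split=> //=; rewrite in_itv.
apply: ae_imp (ae_and dS aeG) => t [[dSt dSw] Gt] tT; split=> //.
- by split=> //; rewrite -derive1E.
- rewrite /w patchE mem_set; last exact: Gt.
  by rewrite /v sqr_sqrtr// rdot_ge0.
Qed.

(** A curve of arbitrary speed is compared with the arc through the parameter
    tau proportional to S + e t.  The term e t keeps the derivative of tau
    positive where the curve stops; e then tends to 0, and K to 1/2. *)
Lemma arc_lower_bound {R : realType} {n : nat} (a T : R)
    (c0 c1 : 'M[R[i]]_(1 + (n - 1), 1)) (g : R -> 'M[R[i]]_(1 + (n - 1), 1)) :
  (0 < n)%N -> frame a c0 c1 -> 0 < T -> horizontal_curve n 1 T g ->
  g 0 = two_mode a (1 - a) c0 c1 0 -> g T = two_mode a (1 - a) c0 c1 (2 * pi) ->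
  ((Num.sqrt (4 * n%:R) * (2 * pi * Num.sqrt (a * (1 - a))))%:E <= curve_length n 1 T g)%E.
Proof.
move=> n0 fr T0 hg g0 gT.
have [->|lt] := eqVneq (curve_length n 1 T g) +oo%E; first exact: leey.
have {}lt : (curve_length n 1 T g < +oo)%E by rewrite ltey.
have [S [w [acS S0 ST Smono dS]]] := horizontal_arclength T0 n0 hg lt.
apply: le_trans ST; rewrite lee_fin ler_wpM2l ?sqrtr_ge0//.
have pi0 := @pi_gt0 R; have pi20 : 0 < 2 * pi :> R by rewrite mulr_gt0.
have ab0 : 0 <= a * (1 - a) by have [<- <- _ _] := fr; rewrite mulr_ge0// rdot_ge0.
have ST0 : 0 <= S T by rewrite -S0 Smono// ltW.
apply/ler_addgt0Pr => e0 e00; pose e := e0 / T.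
have e_gt0 : 0 < e by rewrite divr_gt0.
have -> : e0 = e * T by rewrite /e divfK// gt_eqF.
set L := S T + e * T; have L0 : 0 < L by rewrite ltr_wpDl// mulr_gt0.
rewrite mulrC -ler_pdivlMr// -[L / _]gtr0_norm ?divr_gt0// -sqrtr_sqr ler_sqrt ?sqr_ge0//.
apply/ler_addgt0Pr => eta eta0.
(* As the gap is at most 4, the loss (1/4 - K^2) D is at most
   4 dl (1 - dl) <= eta for K = 1/2 - dl. *)
pose dl := Num.min 4^-1 (eta / 4); pose K := 2^-1 - dl.
have dl0 : 0 < dl by rewrite lt_min invr_gt0 ltr0n/= divr_gt0.
have [dl4 dle] : dl <= 4^-1 /\ dl <= eta / 4 by rewrite !ge_min !lexx orbT.
have K0 : 0 < K by rewrite /K; lra.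
have Kpi : K * pi < pi / 2.
  by rewrite mulrC ltr_pM2l// /K; lra.
have K4 : 0 <= 4^-1 - K ^+ 2 /\ 4 * (4^-1 - K ^+ 2) <= eta.
  have E : 4^-1 - K ^+ 2 = dl * (1 - dl) by rewrite /K; field.
  rewrite E; split; first by rewrite mulr_ge0//; lra.
  have : dl * (1 - dl) <= dl * 1 by rewrite ler_pM2l//; lra.
  by lra.
have [cos0 cosd] := cos_ge_window K0 (ltW pi0) Kpi.
pose c := 2 * pi / L; have c0' : 0 < c by rewrite divr_gt0.
pose tau t := c * (S t + e * t).
have actau : absolutely_continuous 0 T tau.
  apply: ac_scale; apply: ac_add => //; apply: ac_scale.
  by apply: (@ac_lipschitz _ _ _ 1) => // u v _ uv _; rewrite mul1r ger0_norm// subr_ge0.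
have cL : c * L = 2 * pi by rewrite /c divfK// gt_eqF.
have tau_range t : 0 <= t -> t <= T -> 0 <= tau t <= 2 * pi.
  move=> t0 tT; have St0 : 0 <= S t by rewrite -S0 Smono.
  apply/andP; split.
    have et0 : 0 <= e * t by rewrite mulr_ge0// ltW.
    by apply: mulr_ge0; [exact: ltW|exact: addr_ge0].
  by rewrite -cL ler_pM2l// lerD ?Smono// ler_pM2l.
pose sg t := c * (w t + e).
have dtau : {ae lebesgue_measure, forall t : R, 0 < t < T -> is_derive t (1 : R) tau (sg t)}.
  apply: ae_imp dS => t Ht tT; have [dSt _ _] := Ht tT.
  exact: (is_derive_scale c (is_derive_add dSt (is_derive_lin e t))).
have [ach rateh] := calibrated_ae fr T0 hg actau tau_range cos0 cosd dtau.
set h := fun t => calibration a K pi c0 c1 (g t) (tau t) in ach rateh.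
have h0 : h 0 = 0.
  by rewrite /h /tau S0 !mulr0 addr0 mulr0 g0; exact: calibration_arc.
have hT : h T = 0.
  by rewrite /h /tau -/L cL gT; exact: calibration_arc.
pose M := (L / (2 * pi)) ^+ 2 - a * (1 - a) + eta.
suff : M * tau 0 - h 0 <= M * tau T - h T.
  rewrite h0 hT !subr0 /tau -/L cL S0 !mulr0 addr0 !mulr0.
  by rewrite pmulr_lge0// /M; lra.
apply: (@ac_nondecreasing _ 0 T (fun t => M * tau t - h t)); first exact: ltW.
  by apply: ac_sub => //; exact: ac_scale.
apply: ae_imp (ae_and (ae_and dS rateh) (ae_and dtau (horizontal_curve_ae hg)))
  => t [[H1 H2] [H3 H4]] tT.
have [_ w0 wE] := H1 tT; have [dh [ddh le]] := H2 tT; have dt := H3 tT; have [_ _ xx _] := H4 tT.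
have H := is_derive_sub (is_derive_scale M dt) ddh.
rewrite derive1E (@derive_val _ _ _ _ _ _ _ H); split; first by case: H.
have sg0 : 0 < sg t by rewrite mulr_gt0// ltr_wpDl.
rewrite subr_ge0 -(ler_pM2l sg0); apply: (le_trans le).
have gp0 := gap_ge0 fr (tau t) xx; have gp4 := gap_le4 fr (tau t) xx.
have wsg : w t ^+ 2 <= sg t ^+ 2 * (L / (2 * pi)) ^+ 2.
  rewrite -exprMn; have -> : sg t * (L / (2 * pi)) = w t + e.
    have cancel (p l x : R) : 0 < p -> 0 < l -> p / l * x * (l / p) = x.
      by move=> p0 l0; field; rewrite !gt_eqF.
    by rewrite /sg /c cancel.
  by rewrite ler_pXn2r ?nnegrE//; lra.
have gapb : (4^-1 - K ^+ 2) * gap a c0 c1 (g t) (tau t) <= eta.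
  by have [k1 k2] := K4; have := ler_wpM2l k1 gp4; lra.
have := ler_wpM2l (sqr_ge0 (sg t)) gapb; rewrite -wE /M; lra.
Qed.

(** * Arcs through a given point *)

Lemma unit_circle_angle {R : realType} (x y : R) : x ^+ 2 + y ^+ 2 = 1 ->
  exists th, [/\ 0 <= th, th < 2 * pi, x = cos th & y = sin th].
Proof.
move=> xy; have pi0 := @pi_gt0 R.
have x1 : -1 <= x <= 1.
  rewrite -ler_norml -(@ler_pXn2r _ 2%N) ?nnegrE// real_normK ?num_real// expr1n -xy.
  by rewrite lerDl sqr_ge0.
have cx : cos (acos x) = x by rewrite acosK// in_itv/=.
have sx : sin (acos x) = `|y|.
  by rewrite sin_acos// -sqrtr_sqr; congr Num.sqrt; rewrite -xy; ring.
have a0 := acos_ge0 x1; have api := acos_lepi x1.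
have [y0|y0] := leP 0 y.
  by exists (acos x); split=> //; [lra|rewrite sx ger0_norm].
exists (pi *+ 2 - acos x); split.
- by rewrite mulr2n; lra.
- rewrite mulr_natl gtrBl lt_neqAle a0 andbT eq_sym; apply/eqP => ac0.
  by move: sx; rewrite ac0 sin0 => /esym/eqP; rewrite normr_eq0 lt_eqF.
- by rewrite addrC cosD2pi cosN.
- by rewrite addrC sinD2pi sinN sx ltr0_norm// opprK.
Qed.

Lemma polar_coordinates {R : realType} (x y : R) : exists r th,
  [/\ 0 <= r, r ^+ 2 = x ^+ 2 + y ^+ 2, 0 <= th <= 2 * pi & x = r * cos th /\ y = r * sin th].
Proof.
have pi0 := @pi_gt0 R.
pose r := Num.sqrt (x ^+ 2 + y ^+ 2).
have r2 : r ^+ 2 = x ^+ 2 + y ^+ 2 by rewrite sqr_sqrtr// addr_ge0// sqr_ge0.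
have r0 : 0 <= r by exact: sqrtr_ge0.
have [rz|rn] := eqVneq r 0.
  exists 0, 0; rewrite lexx expr0n/= !mul0r; split=> //; first by rewrite -r2 rz expr0n.
    by rewrite mulr_ge0// ltW.
  move: r2; rewrite rz expr0n/= => /esym/eqP.
  by rewrite paddr_eq0 ?sqr_ge0// !sqrf_eq0 => /andP[/eqP-> /eqP->].
have [|th [th0 th2 xE yE]] := @unit_circle_angle R (x / r) (y / r).
  by rewrite !exprMn -mulrDl -r2 -exprMn divff// expr1n.
exists r, th; split=> //; first by rewrite th0 ltW.
by rewrite -xE -yE !mulrA ![r * _]mulrC !mulfK.
Qed.

(** The first coordinates of the arcs fill the open unit disc.  With t = 2 s and
    mu = 1 - 2 a the right-hand sides are the parts of
    exp(- i mu s) (cos s + i mu sin s).  Fix the modulus r and an angle f, and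
    choose s and mu with cos s = r cos f and mu sin s = r sin f; the value is
    then r exp(i (f - mu s)).  As r < 1, the phase F(f) = f - mu s is continuous
    in f.  It is 0 at 0 and 2 pi at 2 pi, hence takes every value between. *)
Lemma disc_parametrization {R : realType} (x y : R) : x ^+ 2 + y ^+ 2 < 1 ->
  exists a t, [/\ 0 < a < 1, 0 < t < 2 * pi,
    x = (1 - a) * cos (a * t) + a * cos ((1 - a) * t) &
    y = (1 - a) * sin (a * t) - a * sin ((1 - a) * t)].
Proof.
move=> xy1; have pi0 := @pi_gt0 R.
have [r [psi [r0 r2 psi2 [xE yE]]]] := polar_coordinates x y.
have r1 : r ^+ 2 < 1 by rewrite r2.
have rcos2 (f : R) : (r * cos f) ^+ 2 < 1.
  have c1 : cos f ^+ 2 <= 1 by rewrite -(cos2Dsin2 f) lerDl sqr_ge0.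
  by apply: le_lt_trans r1; rewrite exprMn ler_piMr ?sqr_ge0.
have rcos (f : R) : -1 < r * cos f < 1.
  by rewrite -ltr_norml -(@ltr_pXn2r _ 2%N) ?nnegrE// real_normK ?num_real// expr1n.
pose sn f := Num.sqrt (1 - (r * cos f) ^+ 2).
have sn0 f : 0 < sn f by rewrite sqrtr_gt0 subr_gt0.
pose mu f := r * sin f / sn f.
pose F f := f - mu f * acos (r * cos f).
have cF : continuous F.
  have crc : continuous (fun f => r * cos f).
    by move=> f; apply: cvgM; [exact: cvg_cst|exact: continuous_cos].
  move=> f; apply: cvgB; first exact: cvg_id.
  apply: cvgM; last first.
    apply: (@continuous_comp _ _ _ (fun f => r * cos f) acos); first exact: crc.
    by apply: continuous_acos.
  apply: cvgM.
    by apply: cvgM; [exact: cvg_cst|exact: continuous_sin].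
  apply: cvgV; first by rewrite gt_eqF.
  apply: (@continuous_comp _ _ _ (fun f => 1 - (r * cos f) ^+ 2) Num.sqrt); last first.
    exact: sqrt_continuous.
  apply: cvgB; first exact: cvg_cst.
  rewrite [X in X @ _ --> _](_ : _ = fun f => (r * cos f) * (r * cos f)) ?expr2//.
    by apply: cvgM; exact: crc.
have F0 : F 0 = 0 by rewrite /F /mu sin0 mulr0 !mul0r subr0.
have F2 : F (2 * pi) = 2 * pi.
  by rewrite /F /mu mulr_natl sin2pi mulr0 !mul0r subr0.
have p2 : 0 <= 2 * pi :> R by rewrite mulr_ge0// ltW.
have [|f _ Ff] := @IVT R F 0 (2 * pi) psi p2 (continuous_subspaceT cF).
  by rewrite F0 F2 (min_idPl p2) (max_idPr p2).
set s := acos (r * cos f).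
have rc1 : -1 <= r * cos f <= 1 by case/andP: (rcos f) => *; rewrite !ltW.
have cs : cos s = r * cos f by rewrite acosK// in_itv/=.
have ss : sin s = sn f by rewrite sin_acos.
have s0 : 0 < s by apply: acos_gt0; case/andP: (rcos f) => /ltW -> ->.
have spi : s < pi by apply: acos_ltpi; case/andP: (rcos f) => -> /ltW ->.
have ms : mu f * sin s = r * sin f by rewrite ss /mu divfK// gt_eqF.
have mu1 : `|mu f| < 1.
  rewrite normrM normfV (gtr0_norm (sn0 f)) ltr_pdivrMr// mul1r.
  rewrite -(@ltr_pXn2r _ 2%N) ?nnegrE ?(ltW (sn0 f))// real_normK ?num_real//.
  rewrite /sn sqr_sqrtr ?subr_ge0 ?(ltW (rcos2 f))// !exprMn ltrBrDr -mulrDr addrC.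
  by rewrite cos2Dsin2 mulr1.
move: mu1; rewrite ltr_norml => /andP[mu1 mu2].
exists ((1 - mu f) / 2), (2 * s); split.
- by apply/andP; split; lra.
- by apply/andP; split; lra.
- have -> : (1 - mu f) / 2 * (2 * s) = s - mu f * s by field.
  have -> : (1 - (1 - mu f) / 2) * (2 * s) = s + mu f * s by field.
  rewrite cosB cosD xE -Ff /F -/s cosB mulrDr !mulrA -cs -ms.
  by field.
- have -> : (1 - mu f) / 2 * (2 * s) = s - mu f * s by field.
  have -> : (1 - (1 - mu f) / 2) * (2 * s) = s + mu f * s by field.
  rewrite sinB sinD yE -Ff /F -/s sinB mulrBr !mulrA -cs -ms.
  by field.
Qed.

Lemma rdot_col_mx {R : realType} {m p : nat} (A C : 'cV[R[i]]_m) (B D : 'cV[R[i]]_p) :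
  rdot (col_mx A B) (col_mx C D) = rdot A C + rdot B D.
Proof.
rewrite /rdot big_split_ord /=; congr (_ + _); apply: eq_bigr => j _.
  by rewrite !col_mxEu.
by rewrite !col_mxEd.
Qed.

Lemma idot_col_mx {R : realType} {m p : nat} (A C : 'cV[R[i]]_m) (B D : 'cV[R[i]]_p) :
  idot (col_mx A B) (col_mx C D) = idot A C + idot B D.
Proof.
rewrite /idot big_split_ord /=; congr (_ + _); apply: eq_bigr => j _.
  by rewrite !col_mxEu.
by rewrite !col_mxEd.
Qed.

Lemma rdot_scalar {R : realType} (z w : R[i]) :
  rdot (z%:M : 'cV_1) (w%:M) = Re z * Re w + Im z * Im w.
Proof. by rewrite /rdot big_ord1 !mxE eqxx !mulr1n. Qed.

Lemma idot_scalar {R : realType} (z w : R[i]) :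
  idot (z%:M : 'cV_1) (w%:M) = Re z * Im w - Im z * Re w.
Proof. by rewrite /idot big_ord1 !mxE eqxx !mulr1n. Qed.

Section StandardFrame.
Context {R : realType} {p : nat}.
Variables (a : R) (v : 'cV[R[i]]_p).

(** The frames with c0 + c1 = e1: the first coordinates are then 1 - a and a,
    and the other coordinates are opposite, with |v|^2 = a (1 - a). *)
Definition mode0 : 'cV[R[i]]_(1 + p) := col_mx ((1 - a) +i* 0)%C%:M (- v).
Definition mode1 : 'cV[R[i]]_(1 + p) := col_mx (a +i* 0)%C%:M v.

Lemma standard_frame : rdot v v = a * (1 - a) -> frame a mode0 mode1.
Proof.
move=> vv; rewrite /frame /mode0 /mode1 !rdot_col_mx idot_col_mx.
have idN : idot (- v) v = 0.
  by apply: big1 => j _; rewrite mxE; case: (v j 0) => x y /=; ring.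
by rewrite !rdot_scalar idot_scalar !dotE vv idN /=; split; ring.
Qed.

Lemma standard_arc al be t : two_mode al be mode0 mode1 t =
  col_mx (((1 - a) * cos (al * t) + a * cos (be * t)) +i*
          ((1 - a) * sin (al * t) - a * sin (be * t)))%C%:M
    (((cos (be * t) - cos (al * t)) +i* (- sin (be * t) - sin (al * t)))%C *: v).
Proof.
rewrite /two_mode /mode0 /mode1 !scale_col_mx add_col_mx; congr col_mx.
  apply/matrixP => i j; rewrite !ord1 !mxE eqxx !mulr1n /cis cosN sinN.
  by apply/eqP; rewrite eq_complex /=; apply/andP; split; apply/eqP; ring.
rewrite scalerN -scaleNr -scalerDl /cis cosN sinN; congr (_ *: _).
by apply/eqP; rewrite eq_complex /=; apply/andP; split; apply/eqP; ring.
Qed.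

Lemma standard_arc_start al be :
  two_mode al be mode0 mode1 0 = col_mx 1%:M 0.
Proof.
rewrite standard_arc !mulr0 cos0 sin0.
have -> : ((1 - 1) +i* (- 0 - 0))%C = 0 :> R[i] by rewrite subrr !oppr0 addr0.
rewrite scale0r; congr (col_mx _%:M _).
by apply/eqP; rewrite eq_complex /=; apply/andP; split; apply/eqP; ring.
Qed.

Lemma standard_arc_end :
  two_mode a (1 - a) mode0 mode1 (2 * pi) = col_mx (cis (2 * pi * a))%:M 0.
Proof.
have E : (1 - a) * (2 * pi) = - (2 * pi * a) + pi *+ 2 by rewrite mulr2n; ring.
rewrite standard_arc E cosD2pi sinD2pi cosN sinN (mulrC a).
have -> : ((cos (2 * pi * a) - cos (2 * pi * a)) +i*
    (- - sin (2 * pi * a) - sin (2 * pi * a)))%C = 0 :> R[i].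
  by rewrite opprK !subrr.
rewrite scale0r; congr (col_mx _%:M _).
by apply/eqP; rewrite eq_complex /=; apply/andP; split; apply/eqP; ring.
Qed.

End StandardFrame.

(** The first coordinate of y determines a and t0.  The remaining coordinates
    of the arc are k v with k = exp(- i (1 - a) t0) - exp(i a t0), which is not
    0, so v is obtained by dividing those of y by k. *)
Lemma arc_through {R : realType} {p : nat} (y : 'cV[R[i]]_(1 + p)) :
  rdot y y = 1 -> dsubmx y != 0 ->
  exists a t0 v, [/\ 0 < a < 1, 0 < t0 < 2 * pi, rdot v v = a * (1 - a) &
    y = two_mode a (1 - a) (mode0 a v) (mode1 a v) t0].
Proof.
move=> yy wn0; pose z := usubmx y 0 0; pose w := dsubmx y.
have yE : y = col_mx z%:M w by rewrite -[LHS]vsubmxK /z -mx11_scalar.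
have zw : Re z ^+ 2 + Im z ^+ 2 + rdot w w = 1.
  by rewrite -yy {1 2}yE rdot_col_mx rdot_scalar !expr2.
have w0 : 0 < rdot w w.
  by rewrite lt_neqAle rdot_ge0 andbT eq_sym; apply: contraNneq wn0 => /rdot_eq0 w0; apply/eqP.
have [|a [t0 [a01 t02 zre zim]]] := @disc_parametrization R (Re z) (Im z); first by lra.
pose k1 := cos ((1 - a) * t0) - cos (a * t0).
pose k2 := - sin ((1 - a) * t0) - sin (a * t0).
have kN : a * (1 - a) * (k1 ^+ 2 + k2 ^+ 2) = rdot w w.
  have -> : rdot w w = 1 - (Re z ^+ 2 + Im z ^+ 2) by lra.
  rewrite zre zim /k1 /k2.
  have h1 := cos2Dsin2 (a * t0); have h2 := cos2Dsin2 ((1 - a) * t0).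
  set C1 := cos (a * t0) in h1 *; set S1 := sin (a * t0) in h1 *.
  set C2 := cos _ in h2 *; set S2 := sin _ in h2 *.
  transitivity ((1 - a) * a * (C1 ^+ 2 + S1 ^+ 2) + a * (1 - a) * (C2 ^+ 2 + S2 ^+ 2) -
    2 * a * (1 - a) * (C1 * C2 - S1 * S2)); first by ring.
  transitivity (1 - ((1 - a) ^+ 2 * (C1 ^+ 2 + S1 ^+ 2) + a ^+ 2 * (C2 ^+ 2 + S2 ^+ 2) +
    2 * a * (1 - a) * (C1 * C2 - S1 * S2))); last by ring.
  by rewrite h1 h2; ring.
have ab0 : 0 < a * (1 - a) by case/andP: a01 => *; rewrite mulr_gt0// subr_gt0.
have k0 : 0 < k1 ^+ 2 + k2 ^+ 2 by rewrite -(pmulr_rgt0 _ ab0) kN.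
set N := k1 ^+ 2 + k2 ^+ 2 in kN k0.
exists a, t0, ((k1 / N +i* - (k2 / N))%C *: w); split=> //.
  rewrite !dotE idot_self -kN.
  transitivity (a * (1 - a) * N * (k1 ^+ 2 + k2 ^+ 2) / N ^+ 2).
    by field; rewrite gt_eqF.
  by rewrite -/N; field; rewrite gt_eqF.
rewrite standard_arc yE; congr col_mx.
  by congr (_%:M); apply/eqP; rewrite eq_complex /= zre zim !eqxx.
rewrite scalerA -/k1 -/k2; have -> : (k1 +i* k2)%C * (k1 / N +i* - (k2 / N))%C = 1.
  apply/eqP; rewrite eq_complex /=; apply/andP; split; apply/eqP.
    transitivity (N / N); last by rewrite divff// gt_eqF.
    by rewrite {3}/N; ring.
  by ring.
by rewrite scale1r.
Qed.

Section Minimizers.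
Context {R : realType} {n : nat}.
Implicit Types (g : R -> 'M[R[i]]_(1 + (n - 1), 1)) (T B : R).

Lemma sr_dist_le T g : 0 < T -> horizontal_curve n 1 T g ->
  (sr_dist n 1 (g 0%R) (g T) <= curve_length n 1 T g)%E.
Proof. by move=> T0 hg; apply: ereal_inf_lbound; exists T, g. Qed.

(** The constant speed c of a minimizer satisfies c T = length <= sqrt(4 n) B. *)
Lemma minimizing_speed_le T g B : (0 < n)%N -> 0 < T -> 0 <= B ->
  minimizing_geodesic n 1 T g ->
  (sr_dist n 1 (g 0%R) (g T) <= (Num.sqrt (4 * n%:R) * B)%:E)%E ->
  {ae lebesgue_measure, forall t : R, 0 < t < T ->
    rdot (velocity g t) (velocity g t) <= (B / T) ^+ 2}.
Proof.
move=> n0 T0 B0 [hg len [c sc]]; rewrite -len => lenB.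
pose C := Num.sqrt (4 * n%:R) : R.
have C0 : 0 < C by rewrite sqrtr_gt0 mulr_gt0// ltr0n.
have BT0 : 0 <= B / T by rewrite divr_ge0// ltW.
have cB : c <= C * (B / T).
  rewrite leNgt; apply/negP => Bc.
  have c0 : 0 < c by apply: le_lt_trans Bc; rewrite mulr_ge0// ltW.
  have : ((c * T)%:E <= curve_length n 1 T g)%E.
    have -> : (c * T)%:E = (\int[lebesgue_measure]_(t in `[0%R, T]) c%:E)%E.
      by rewrite integral_cst//= lebesgue_measure_itv/= lte_fin T0 -EFinB -EFinM subr0.
    case: sc => N [mN N0 badN].
    apply: (ge0_le_integral_negligible mN N0).
    - by move=> t _; rewrite lee_fin ltW.
    - by move=> t _; rewrite lee_fin sqrtr_ge0.
    - move=> t /= tT Nt; rewrite lee_fin.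
      have -> // : speed n 1 g t = c.
      apply: contrapT => ne; apply: Nt; apply: badN => /= H; apply: ne; apply: H.
      by move: tT; rewrite in_itv.
  move=> /le_trans/(_ lenB); rewrite lee_fin -ler_pdivlMr// -mulrA leNgt.
  by rewrite Bc.
apply: ae_imp (ae_and (horizontal_curve_ae hg) sc) => t [H1 H2] tT.
have [_ hs _ _] := H1 tT.
have tI : 0 <= t <= T by case/andP: tT => *; rewrite !ltW.
have := H2 tI; rewrite speedE// => E; move: cB; rewrite -E ler_pM2l// => sB.
by rewrite -(sqr_sqrtr (rdot_ge0 _)) ler_pXn2r ?nnegrE// sqrtr_ge0.
Qed.

(** If the velocity vanishes almost everywhere, Re <g 0, g s> stays equal to 1,
    and two unit vectors with product 1 are equal. *)
Lemma zero_speed_constant T g : horizontal_curve n 1 T g ->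
  {ae lebesgue_measure, forall t : R, 0 < t < T ->
    rdot (velocity g t) (velocity g t) <= 0} ->
  forall t, 0 <= t <= T -> g t = g 0.
Proof.
move=> hg slow t /andP[t0 tT]; have [sg acg _] := hg.
have T0 : 0 <= T by exact: le_trans tT.
have gg s : 0 <= s <= T -> rdot (g s) (g s) = 1 by move=> /sg /stiefel1E.
have g01 : rdot (g 0) (g 0) = 1 by apply: gg; rewrite lexx.
have gt1 : rdot (g t) (g t) = 1 by apply: gg; rewrite t0.
suff : rdot (g 0) (g 0) <= rdot (g 0) (g t).
  rewrite g01 => le; apply/eqP; rewrite -subr_eq0; apply/eqP/rdot_eq0.
  apply/eqP; rewrite eq_le rdot_ge0 andbT.
  rewrite !dotE gt1 g01 (rdotC (g t)); lra.
apply: (@ac_nondecreasing _ 0 t (fun s => rdot (g 0) (g s))) => //.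
  by apply: (@ac_subitv _ 0 T) => //; exact: ac_rdot.
apply: ae_imp (ae_and slow (horizontal_curve_ae hg)) => s [H1 H2] /andP[s0 st].
have sT : 0 < s < T by rewrite s0 (lt_le_trans st).
have [dg _ _ _] := H2 sT.
have v0 : velocity g s = 0.
  by apply: rdot_eq0; apply/eqP; rewrite eq_le rdot_ge0 H1.
have H := is_derive_rdot (g 0) dg.
rewrite derive1E (@derive_val _ _ _ _ _ _ _ H); split; first by case: H.
by rewrite v0 /rdot big1// => j _; rewrite mxE /=; ring.
Qed.

End Minimizers.

(** * The cut locus *)

Section CutLocus.
Local Open Scope sesquilinear_scope.
Context {R : realType} {n : nat}.
Hypothesis n2 : (2 <= n)%N.

Let e1 : 'M[R[i]]_(1 + (n - 1), 1) := col_mx 1%:M 0.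

Let n0 : (0 < n)%N. Proof. exact: ltnW. Qed.

Lemma pi1_block_mx (C : 'M[R[i]]_1) (D : 'M[R[i]]_(n - 1)) :
  pi1 n 1 (block_mx C 0 0 D) = col_mx C 0.
Proof. by rewrite /pi1 block_mxEh row_mxKl. Qed.

Lemma pi1_1 : pi1 n 1 (1%:M : 'M[R[i]]_(1 + (n - 1))) = col_mx 1%:M 0.
Proof. by rewrite scalar_mx_block pi1_block_mx. Qed.

Lemma unitary_1P (C : 'M[R[i]]_1) :
  unitary_group R 1 C <-> Re (C 0 0) ^+ 2 + Im (C 0 0) ^+ 2 = 1.
Proof.
have CE : C = (C 0 0)%:M by exact: mx11_scalar.
have E : C *m C^t* = (Re (C 0 0) ^+ 2 + Im (C 0 0) ^+ 2)%:C%C%:M.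
  apply/matrixP => i j; rewrite !ord1 !mxE big_ord1 !mxE eqxx mulr1n.
  case: (C 0 0) => x y; apply/eqP; rewrite eq_complex /=.
  by apply/andP; split; apply/eqP; ring.
rewrite /unitary_group /=; split.
  move=> /unitarymxP; rewrite E => /matrixP/(_ 0 0).
  by rewrite !mxE eqxx !mulr1n => -[].
by move=> C1; apply/unitarymxP; rewrite E C1.
Qed.

Lemma minimizing_unique T g1 g2 y : 0 < T -> dsubmx y != 0 ->
  minimizing_geodesic n 1 T g1 -> minimizing_geodesic n 1 T g2 ->
  g1 0 = e1 -> g2 0 = e1 -> g1 T = y -> g2 T = y ->
  forall t, 0 <= t <= T -> g1 t = g2 t.
Proof.
move=> T0 wn0 m1 m2 g10 g20 g1T g2T.
have yy : rdot y y = 1.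
  have [[sg _ _] _ _] := m1; rewrite -g1T; apply/stiefel1E/sg.
  by rewrite lexx ltW.
have [a [t0 [v [a01 t02 vv yE]]]] := arc_through yy wn0.
have fr := standard_frame vv.
have t00 : 0 < t0 by case/andP: t02.
have ab0 : 0 <= a * (1 - a) by rewrite -vv rdot_ge0.
pose G (t : R) : 'M[R[i]]_(1 + (n - 1), 1) :=
  two_mode a (1 - a) (mode0 a v) (mode1 a v) t.
have G0 : G 0 = e1 by exact: standard_arc_start.
have Gt0 : G t0 = y by rewrite yE.
have dist_le : (sr_dist n 1 e1 y <= (Num.sqrt (4 * n%:R) * (t0 * Num.sqrt (a * (1 - a))))%:E)%E.
  pose A : R -> 'M[R[i]]_(1 + (n - 1), 1) := geodesic_arc a 1 (mode0 a v) (mode1 a v).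
  have AG : A = G by rewrite /A /geodesic_arc !mul1r.
  have := sr_dist_le t00 (arc_horizontal 1 fr t0).
  rewrite -/A (arc_length fr ler01 (ltW t00)) AG G0 Gt0 mul1r.
  by rewrite -mulrA (mulrC _ t0).
have key g : minimizing_geodesic n 1 T g -> g 0 = e1 -> g T = y ->
    forall t, 0 <= t <= T -> g t = G (t0 / T * t).
  move=> mg g0 gT; have [hg _ _] := mg.
  apply: (arc_unique fr T0 hg) => //.
  - by rewrite g0 -G0.
  - by rewrite gT -Gt0.
  - have B0 : 0 <= t0 * Num.sqrt (a * (1 - a)) by rewrite mulr_ge0 ?sqrtr_ge0// ltW.
    have := minimizing_speed_le n0 T0 B0 mg; rewrite g0 gT => /(_ dist_le).
    apply: ae_imp => t H tT; apply: le_trans (H tT) _.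
    by rewrite mulrAC exprMn sqr_sqrtr.
by move=> t tT; rewrite (key g1)// (key g2).
Qed.

(** The distance from e1 to itself is 0, by the constant curve, which is an arc
    run with time scale 0. *)
Lemma minimizing_loop T g : 0 < T -> minimizing_geodesic n 1 T g ->
  g 0 = e1 -> g T = e1 -> forall t, 0 <= t <= T -> g t = e1.
Proof.
move=> T0 mg g0 gT; have [hg _ _] := mg.
have fr : frame (0 : R) (mode0 0 (0 : 'cV_(n - 1))) (mode1 0 0).
  by apply: standard_frame; rewrite mul0r; apply: big1 => j _; rewrite mxE /=; ring.
have dist0 : (sr_dist n 1 (g 0%R) (g T) <= (Num.sqrt (4 * n%:R) * 0)%:E)%E.
  have := sr_dist_le (ltr01 : 0 < 1 :> R) (arc_horizontal 0 fr 1).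
  rewrite (arc_length fr (lexx 0) ler01) /geodesic_arc !mul0r.
  have tm s : two_mode 0 0 (mode0 0 (0 : 'cV_(n - 1))) (mode1 0 0) s = e1.
    by rewrite -[RHS](standard_arc_start 0 0 0 0) /two_mode !mul0r.
  by rewrite !tm g0 gT !mulr0 mul0r.
have slow := minimizing_speed_le n0 T0 (lexx 0) mg dist0.
move=> t tT; rewrite -g0; apply: (zero_speed_constant hg) tT.
by apply: ae_imp slow => s H /H; rewrite mul0r expr0n.
Qed.

Lemma arc_minimizing (a : R) (v : 'cV[R[i]]_(n - 1)) :
  rdot v v = a * (1 - a) ->
  minimizing_geodesic n 1 (2 * pi)
    (two_mode a (1 - a) (mode0 a v) (mode1 a v)).
Proof.
move=> vv; have fr := standard_frame vv; have pi0 := @pi_gt0 R.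
have p2 : 0 < 2 * pi :> R by rewrite mulr_gt0.
pose A : R -> 'M[R[i]]_(1 + (n - 1), 1) := geodesic_arc a 1 (mode0 a v) (mode1 a v).
have -> : two_mode a (1 - a) (mode0 a v) (mode1 a v) = A.
  by rewrite /A /geodesic_arc !mul1r.
have hA : horizontal_curve n 1 (2 * pi) A by exact: arc_horizontal.
split=> //; last first.
  exists (Num.sqrt (4 * n%:R) * (1 * Num.sqrt (a * (1 - a)))).
  by apply: aeW => t _; exact: arc_speed.
apply/eqP; rewrite eq_le sr_dist_le// andbT.
apply: le_ereal_inf_tmp => _ [T [g [T0 hg g0 gT ->]]].
rewrite (arc_length fr ler01 (ltW p2)) mul1r -mulrA (mulrC _ (2 * pi)).
by apply: (arc_lower_bound n0 fr T0 hg);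
  rewrite ?g0 ?gT /A /geodesic_arc !mul1r.
Qed.

(** The vectors v and - v give arcs with the same ends; at time pi their
    coordinates orthogonal to e1 are opposite and not 0. *)
Lemma axis_two_minimizers (C : 'M[R[i]]_1) : unitary_group R 1 C ->
  col_mx C 0 <> e1 -> cut_locus n 1 e1 (col_mx C 0).
Proof.
move=> /unitary_1P CU Cne; have pi0 := @pi_gt0 R.
have [th [th0 th2 reC imC]] := unit_circle_angle CU.
have CE : C = (cis th)%:M.
  rewrite [LHS]mx11_scalar; congr (_%:M); rewrite /cis -reC -imC.
  by case: (C 0 0).
have thn : th != 0.
  apply/eqP => thz; apply: Cne; rewrite CE thz /cis cos0 sin0.
  by congr (col_mx _%:M _); apply/eqP; rewrite eq_complex /= !eqxx.
have th_gt0 : 0 < th by rewrite lt_neqAle eq_sym thn.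
have p2 : 0 < 2 * pi :> R by rewrite mulr_gt0.
pose a := th / (2 * pi).
have a0 : 0 < a by rewrite divr_gt0.
have a1 : a < 1 by rewrite ltr_pdivrMr// mul1r.
have ab0 : 0 < a * (1 - a) by rewrite mulr_gt0// subr_gt0.
have pa : 2 * pi * a = th by rewrite mulrC divfK// gt_eqF.
have m0 : (0 < n - 1)%N by rewrite subn_gt0.
pose j0 : 'I_(n - 1) := Ordinal m0.
pose v s : 'cV[R[i]]_(n - 1) := (s * Num.sqrt (a * (1 - a)) +i* 0)%C *: delta_mx j0 0.
have vv s : s ^+ 2 = 1 -> rdot (v s) (v s) = a * (1 - a).
  move=> s1; rewrite !dotE idot_self.
  have -> : rdot (delta_mx j0 0 : 'cV[R[i]]_(n - 1)) (delta_mx j0 0) = 1.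
    rewrite /rdot (bigD1 j0)//= big1 => [|j jn]; rewrite !mxE.
      by rewrite !eqxx /=; ring.
    by rewrite (negbTE jn) /=; ring.
  transitivity (s ^+ 2 * Num.sqrt (a * (1 - a)) ^+ 2); first by ring.
  by rewrite s1 sqr_sqrtr ?ltW// mul1r.
have v1 := vv 1 (expr1n _ _).
have vN1 : rdot (v (-1)) (v (-1)) = a * (1 - a) by apply: vv; rewrite sqrrN expr1n.
pose g s : R -> 'M[R[i]]_(1 + (n - 1), 1) :=
  two_mode a (1 - a) (mode0 a (v s)) (mode1 a (v s)).
exists (2 * pi), (g 1), (g (-1)); split=> //.
- exact: (arc_minimizing v1).
- exact: (arc_minimizing vN1).
- by split; rewrite ?[LHS]standard_arc_start// [LHS]standard_arc_end CE pa.
exists pi; first by rewrite (ltW pi0) ler_peMl ?(ltW pi0)// ler1n.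
have gE s : g s pi = _ := standard_arc a (v s) a (1 - a) pi.
rewrite !gE => /eq_col_mx[_].
have E : (1 - a) * pi = pi - a * pi by ring.
rewrite E cosB sinB cospi sinpi /v !scalerA => /matrixP/(_ j0 0).
rewrite !mxE !eqxx /= !mulr1 => /eqP; rewrite eq_complex /= => /andP[/eqP re /eqP im].
set q := Num.sqrt _ in re im.
have q0 : 0 < q by rewrite sqrtr_gt0.
have h := cos2Dsin2 (a * pi).
have cz : cos (a * pi) = 0.
  by apply: (mulIf (lt0r_neq0 q0)); rewrite mul0r; lra.
have sz : sin (a * pi) = 0.
  by apply: (mulIf (lt0r_neq0 q0)); rewrite mul0r; lra.
by move: h; rewrite cz sz expr0n/= addr0 => /esym/eqP; rewrite oner_eq0.
Qed.

End CutLocus.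

Unset Implicit Arguments.

Theorem theorem3 (R : realType) (n : nat) (hn : (2 <= n)%N) :
  cut_locus n 1 (pi1 n 1 (1%:M : 'M[R[i]]_(1 + (n - 1)))) =
  [set pi1 n 1 (block_mx C 0 0 D) |
     C in unitary_group R 1 & D in unitary_group R (n - 1)]
  `\ pi1 n 1 (1%:M : 'M[R[i]]_(1 + (n - 1))).
Proof.
rewrite pi1_1; apply/seteqP; split=> [y|y [[C CU [D _ <-]]]]; last first.
  by rewrite pi1_block_mx => Cne; exact: axis_two_minimizers.
move=> [T [g1 [g2 [T0 m1 m2 [g10 g20 g1T g2T] [t tT ne]]]]].
have w0 : dsubmx y = 0.
  apply/eqP; apply: contra_notT ne => wn0.
  exact: (minimizing_unique hn T0 wn0 m1 m2).
have yE : y = col_mx (usubmx y) 0 by rewrite -w0 vsubmxK.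
split.
  exists (usubmx y).
    apply/unitary_1P; have [[sg _ _] _ _] := m1.
    have /stiefel1E : stiefel R n 1 (g1 T) by apply: sg; rewrite lexx ltW.
    by rewrite g1T yE rdot_col_mx col_mxKu (mx11_scalar (usubmx y)) rdot_scalar
      /rdot [X in _ + X]big1 ?addr0 ?mxE ?eqxx ?mulr1n// => j _; rewrite mxE /=; ring.
  exists 1%:M; first by apply/unitarymxP; rewrite trmx1 map_mx1 mulmx1.
  by rewrite pi1_block_mx -yE.
move=> /= ye; apply: ne; rewrite ye in g1T g2T.
by rewrite (minimizing_loop hn T0 m1)// (minimizing_loop hn T0 m2).
Qed.
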